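(* Let $d\in\{2g+1,2g+2\}$ with $g\ge 2$. Let $D(s,t)=\mathrm{disc}_x(x^d+sx+t)$. Then the two-parameter family $\mathcal{C}\to\mathrm{Spec}\,\mathbb{Z}[1/2,s,t,D(s,t)^{-1}]$ of genus-$g$ curves $y^2=x^d+sx+t$ is generically ordinary at each prime $p>P^+(d)$.
   Context: $P^+(d)=d^2-4d+2$ if $d=2g+1$, and $P^+(d)=(d^2-3d+2)/2$ if $d=2g+2$. The family $\mathcal{C}$ is the family of smooth projective hyperelliptic curves of genus $g$ with affine equation $y^2=x^d+sx+t$. A smooth projective curve of genus $g$ over a field of characteristic $p>0$ is ordinary if its Jacobian is an ordinary abelian variety, i.e. its Newton polygon has only slopes $0$ and $1$. The family is generically ordinary at $p$ if its restriction to the fiber of the base over $\mathbb{F}_p$ (a nonempty open subscheme of the $(s,t)$-plane $\mathbb{A}^2_{\mathbb{F}_p}$) has ordinary generic fiber, i.e. the curve $y^2=x^d+sx+t$ over $\mathbb{F}_p(s,t)$ is ordinary; equivalently, the ordinary locus in this fiber is a nonempty open subset. *)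

(* Defs.v *)
(* Mathematical Components. *)
From HB Require Import structures.
From mathcomp Require Import all_boot all_order all_algebra all_field.

Set Implicit Arguments.
Unset Strict Implicit.
Unset Printing Implicit Defensive.

Import Order.TTheory GRing.Theory Num.Theory.
Local Open Scope ring_scope.

(* For d >= 4 the truncated subtraction agrees with the one in Z, and
   d^2 - 3d + 2 = (d - 1)(d - 2) is even. *)
Definition Pplus (d : nat) : nat :=
  if odd d then (d ^ 2 - 4 * d + 2)%N else ((d ^ 2 - 3 * d + 2) %/ 2)%N.

Definition trinomial (R : nzRingType) (d : nat) (s t : R) : {poly R} :=
  'X^d + s *: 'X + t%:P.

(* Discriminant of a monic polynomial. Sylvester_mx is built from the actual
   degrees of f and f', so this is only used over Z[s, t], where f' has degree
   exactly d - 1. *)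
Definition monic_disc (R : comNzRingType) (f : {poly R}) : R :=
  let d := (size f).-1 in (-1) ^+ 'C(d, 2) * resultant f f^`().

(* D(s, t) as an element of Z[s, t], realised as {poly {poly int}} with
   s = 'X (outer variable) and t = 'Y (inner variable). *)
Definition disc_st (d : nat) : {poly {poly int}} :=
  monic_disc (trinomial d ('X : {poly {poly int}}) 'Y).

Definition eval_st (R : comNzRingType) (P : {poly {poly int}}) (s t : R) : R :=
  (map_poly (map_poly (intr : int -> R)) P).[s, t].

(* Number of E-points of the smooth projective model of y^2 = f(x), for
   deg f = 2g+1 or 2g+2. The model is obtained by gluing the affine curve
   y^2 = f(x) to v^2 = u^(2g+2) f(1/u) along u = 1/x, v = y/x^(g+1); the points
   missing from the first chart have u = 0 and v^2 = f_(2g+2). *)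
Definition npoints (E : finFieldType) (g : nat) (f : {poly E}) : nat :=
  (#|[set P : E * E | (P.2 ^+ 2 == f.[P.1])%R]|
   + #|[set v : E | (v ^+ 2 == f`_(2 * g + 2))%R]|)%N.

(* L is the numerator of the zeta function L(T) / ((1 - T)(1 - qT)) of the
   genus g curve y^2 = f(x) over F with #|F| = q. The elements of al are the
   eigenvalues of the q-Frobenius on (the Tate module of) the Jacobian: the
   curve has q^r + 1 - \sum_a a^r points over the extension of degree r. The
   numbers of points determine L. *)
Definition is_Lpoly (F : finFieldType) (g : nat) (f : {poly F})
    (L : {poly int}) : Prop :=
  exists al : (2 * g).-tuple algC,
    [/\ size L = (2 * g).+1,
        map_poly (intr : int -> algC) L = \prod_(a <- al) (1 - a *: 'X)
      & forall (r : nat) (E : finFieldType) (iota : {rmorphism F -> E}),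
          (0 < r)%N -> #|E| = (#|F| ^ r)%N ->
          (npoints g (map_poly iota f))%:R
            = (#|F| ^ r)%:R + 1 - \sum_(a <- al) a ^+ r :> algC].

(* The p-adic valuation of a nonzero integer, normalised by v(q) = 1. *)
Definition vq (p q : nat) (c : int) : rat :=
  (logn p `|c|%N)%:R / (logn p q)%:R.

(* lam is the slope of an edge of the Newton polygon of L, i.e. of the lower
   convex hull of the points (i, v(L_i)) with L_i != 0: the line of slope lam
   through two of these points has none of them below it. *)
Definition newton_slope (p q : nat) (L : {poly int}) (lam : rat) : Prop :=
  exists i j : nat,
    [/\ (i < j)%N, L`_i != 0, L`_j != 0,
        vq p q L`_j - vq p q L`_i = lam * (j%:R - i%:R)
      & forall k : nat, L`_k != 0 ->
          vq p q L`_i + lam * (k%:R - i%:R) <= vq p q L`_k].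

Definition ordinary (p : nat) (F : finFieldType) (g : nat) (f : {poly F}) :
    Prop :=
  exists L : {poly int}, is_Lpoly g f L /\
    forall lam : rat, newton_slope p #|F| L lam -> lam = 0 \/ lam = 1.

(* The ordinary locus in the fibre D(s, t) != 0 of the base over F_p is a
   nonempty Zariski open subset. Its points are described by coordinates (s, t)
   in finite fields F of characteristic p, i.e. as points over an algebraic
   closure of F_p; its complement in the fibre is the zero locus of a set S of
   polynomials, taken over Z since only their reductions mod p matter. *)
Definition generically_ordinary (p g d : nat) : Prop :=
  (exists (F : finFieldType) (s t : F),
     [/\ p \in [pchar F], eval_st (disc_st d) s t != 0
       & ordinary p g (trinomial d s t)])
  /\
  (exists S : {poly {poly int}} -> Prop,
     forall (F : finFieldType) (s t : F),
       p \in [pchar F] -> eval_st (disc_st d) s t != 0 ->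
       (ordinary p g (trinomial d s t)
        <-> exists G : {poly {poly int}}, S G /\ eval_st G s t != 0)).

(* Main.v *)
Require Import Defs.
From HB Require Import structures.
From mathcomp Require Import all_boot all_order all_fingroup all_algebra all_field.
From mathcomp Require Import zify ring lra.

Set Implicit Arguments.
Unset Strict Implicit.
Unset Printing Implicit Defensive.

Import Order.TTheory GRing.Theory Num.Theory.
Local Open Scope ring_scope.

(* For f monic, separable of degree d, the quadratic residue symbol chi modulo f
   has a Dirichlet L-function \sum_h chi(h) T^deg(h) over monic h in F_q[x], a
   polynomial of degree d - 1. Its logarithmic derivative counts the points of
   y^2 = f(x), so it is the numerator L of the zeta function, up to a factor
   1 - T when d is even, and its functional equation follows from a finite
   Fourier transform on F_q[x] / (f). The latter makes the curve ordinary iff p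
   does not divide L_g.

   Modulo p, the point counts are sums of f(x)^((q - 1) / 2), hence traces of
   powers of the Hasse-Witt matrix, and Newton's identities in degrees at most
   g < p turn them into L_g = +- det H. For f = x^d + s x + 1, the lowest order
   coefficient in s of det H is, up to units, a determinant of values of
   polynomials P_j of degree < g at the residues r_i of p i modulo d. It is a
   Vandermonde determinant times the determinant of the coefficients of the P_j,
   and the latter is compared with the values of the P_j at 1, ..., g, which form
   a triangular matrix. All the factors involved are nonzero modulo p
   when p > P^+(d). *)

(** * The quadratic character of a finite field *)

(** Ordinarity is stated through point counts over all finite extensions, so character sums suffice:
    neither Jacobians nor the absolute values of the eigenvalues enter. The functional equation
    gives |L_(g+j)| = q^j |L_(g-j)|. The Newton polygon therefore lies above the lines y = 0 and y =
    x - g and joins (0, 0) to (2g, g); its slopes are all 0 or 1 exactly when it passes through (g,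
    0). The bound P^+(d) is what the crude estimates i <= g and r_i <= d - 1 cost: with m = (p -
    1)/2 and p i = a_i d + r_i, they yield a_i + r_i <= m + g precisely for p > P^+(d). This
    inequality allows the lowest coefficients of det H to be written with falling factorials of
    natural numbers. The criterion is the nonvanishing of det H, a polynomial in s and t over Z, so
    openness is immediate. For nonemptiness, t = 1 is fixed and s is taken in a finite field with
    more elements than det H and the discriminant together have roots. *)

Lemma finField_natr_card (F : finFieldType) : #|F|%:R = 0 :> F.
Proof.
have /(congr1 (fun x => x - \sum_(x : F) x)) :
    \sum_(x : F) x = \sum_(x : F) (x + 1).
  by rewrite (reindex_inj (addIr 1)).
by rewrite big_split /= subrr [X in X - _]addrC addrK sumr_const.
Qed.

Lemma card_lt_size_vanishing (F : finFieldType) (h : {poly F}) :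
  h != 0 -> (forall x, x != 0 -> root h x) -> (#|F|.-1 < size h)%N.
Proof.
move=> h0 rh; have -> : #|F|.-1 = size [seq x <- enum F | x != 0].
  rewrite -(cardC1 (0 : F)) cardE; congr size.
  by rewrite /enum_mem -filter_predI; apply: eq_filter => x; rewrite !inE andbT.
apply: max_poly_roots => //; last by rewrite filter_uniq ?enum_uniq.
by apply/allP=> x; rewrite mem_filter => /andP[/rh].
Qed.

Section QuadraticCharacter.

Variable F : finFieldType.
Implicit Types x y : F.

(** Integer values, so that sums of them are point counts. For odd q, [#|F|./2] is (q - 1)/2. *)
Definition qchar x : int :=
  if x == 0 then 0 else if x ^+ #|F|./2 == 1 then 1 else -1.

Lemma qchar0 : qchar 0 = 0.
Proof. by rewrite /qchar eqxx. Qed.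

Lemma qchar1 : qchar 1 = 1.
Proof. by rewrite /qchar oner_eq0 expr1n eqxx. Qed.

Lemma qchar_eq0 x : (qchar x == 0) = (x == 0).
Proof. by rewrite /qchar; case: (x == 0) => //; case: (_ == 1). Qed.

Lemma qchar_sqr x : x != 0 -> qchar x * qchar x = 1.
Proof. by rewrite /qchar => /negPf->; case: (_ == 1). Qed.

Hypothesis oddF : odd #|F|.

Lemma finField_two_neq0 : 2%:R != 0 :> F.
Proof.
apply/eqP=> F2; have := finField_natr_card F.
rewrite -[#|F|]odd_double_half oddF -muln2 natrD natrM F2 mulr0 addr0.
by move/eqP; rewrite oner_eq0.
Qed.

Lemma opp1_neq1 : -1 != 1 :> F.
Proof. by rewrite eq_sym -addr_eq0 finField_two_neq0. Qed.

Lemma card_half_double : (#|F|./2).*2 = #|F|.-1.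
Proof. by rewrite -[in RHS](odd_double_half #|F|) oddF. Qed.

Lemma expf_card1 x : x != 0 -> x ^+ #|F|.-1 = 1.
Proof.
move=> x0; apply: (mulIf x0); rewrite mul1r -exprSr prednK ?expf_card //.
by rewrite (cardD1 0).
Qed.

Lemma qchar_exp x : (qchar x)%:~R = x ^+ #|F|./2.
Proof.
rewrite /qchar; have [->|x0] := eqVneq x 0.
  have := oddF; rewrite expr0n; case: #|F| (finNzRing_gt1 F) => [|[|n]] //.
have [->//|] := eqVneq; have /eqP := expf_card1 x0.
by rewrite -card_half_double -muln2 exprM sqrf_eq1 => /orP[->//|/eqP->].
Qed.

Lemma qchar_val x : [|| qchar x == 0, qchar x == 1 | qchar x == -1].
Proof. by rewrite /qchar; case: (x == 0) => //; case: (_ == 1). Qed.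

(** In odd characteristic 0, 1 and -1 stay distinct; this lifts identities between powers in F to
    identities between symbols in Z. *)
Lemma sign_int_inj (a b : int) :
    [|| a == 0, a == 1 | a == -1] -> [|| b == 0, b == 1 | b == -1] ->
  a%:~R = b%:~R :> F -> a = b.
Proof.
have n11 := opp1_neq1; have n10 := oner_neq0 F; have nm10 : -1 != 0 :> F by rewrite oppr_eq0.
by move=> /or3P[]/eqP-> /or3P[]/eqP-> //= /eqP; rewrite ?[0 == _]eq_sym ?[1 == -1]eq_sym
  ?(negPf n11) ?(negPf n10) ?(negPf nm10).
Qed.

Lemma qcharM x y : qchar (x * y) = qchar x * qchar y.
Proof.
apply: sign_int_inj; first exact: qchar_val.
  by move: (qchar_val x) (qchar_val y) => /or3P[]/eqP-> /or3P[]/eqP->.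
by rewrite rmorphM /= !qchar_exp exprMn.
Qed.

Lemma qcharX x n : qchar (x ^+ n) = qchar x ^+ n.
Proof. by elim: n => [|n IH]; rewrite ?qchar1 // !exprS qcharM IH. Qed.

Lemma qchar_root (S : finFieldType) (phi : {rmorphism F -> S}) x :
  (qchar x)%:~R = phi x ^+ #|F|./2.
Proof. by rewrite -rmorphXn -qchar_exp rmorph_int. Qed.

Lemma qchar_exists : exists x, qchar x = -1.
Proof.
have [x Dx|H] := pickP (fun x => qchar x == -1); first by exists x; apply/eqP.
have F1 := finNzRing_gt1 F; have hF : (0 < #|F|./2)%N.
  by have := card_half_double; move: F1; case: #|F| => [|[|[|n]]].
have X0 : 'X^(#|F|./2) - 1 != 0 :> {poly F} by rewrite -size_poly_eq0 size_XnsubC.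
have := card_lt_size_vanishing X0; rewrite size_XnsubC // -card_half_double -addnn.
move=> small; suff /small : forall x : F, x != 0 -> root ('X^(#|F|./2) - 1) x by lia.
move=> x x0; rewrite /root !hornerE subr_eq0 -qchar_exp.
have := qchar_val x; rewrite qchar_eq0 (negPf x0) H orbF /= => /eqP->.
by rewrite eqxx.
Qed.

Lemma sum_qchar : \sum_x qchar x = 0.
Proof.
have [y Dy] := qchar_exists; have y0 : y != 0 by rewrite -qchar_eq0 Dy.
have : \sum_x qchar x = - \sum_x qchar x.
  rewrite {1}(reindex_inj (mulfI y0)) -sumrN; apply: eq_bigr => x _.
  by rewrite qcharM Dy mulN1r.
lia.
Qed.

(** Only the inequality <= is checked for each [a]. Both sides sum to q over F, as the symbol sums
    to zero, so equality holds everywhere. *)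
Lemma card_sqr (a : F) : #|[set v : F | v ^+ 2 == a]|%:Z = 1 + qchar a.
Proof.
have le_card b : #|[set v : F | v ^+ 2 == b]|%:Z <= 1 + qchar b.
  have [->|b0] := eqVneq b 0.
    rewrite qchar0 (_ : [set _ | _] = [set 0]) ?cards1 //.
    by apply/setP=> v; rewrite !inE expf_eq0.
  have [->|[v]] := set_0Vmem [set v : F | v ^+ 2 == b].
    by rewrite cards0; have := qchar_val b => /or3P[]/eqP->.
  rewrite inE => /eqP Db; have v0 : v != 0.
    by apply: contraNneq b0 => v0; rewrite -Db v0 expr0n.
  have -> : qchar b = 1 by rewrite -Db expr2 qcharM qchar_sqr.
  have -> : [set w : F | w ^+ 2 == b] = [set v; -v].
    by apply/setP=> w; rewrite !inE -Db eqf_sqr.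
  by rewrite cards2; case: (_ != _).
have Z (b : F) : 1 + qchar b - #|[set v : F | v ^+ 2 == b]|%:Z >= 0.
  by rewrite subr_ge0 le_card.
suffices /eqP : \sum_(b : F) (1 + qchar b - #|[set v : F | v ^+ 2 == b]|%:Z) = 0.
  rewrite psumr_eq0 // => /allP/(_ a (mem_index_enum a)).
  by rewrite subr_eq0 => /eqP.
rewrite sumrB big_split /= sum_qchar addr0 sumr_const.
have DF : (\sum_(b : F) #|[set v : F | v ^+ 2 == b]| = #|F|)%N.
  rewrite -[RHS]sum1_card [RHS](partition_big (fun v : F => v ^+ 2) predT) //=.
  by apply: eq_bigr => b _; rewrite -sum1_card; apply: eq_bigl => v; rewrite inE.
by rewrite -(big_morph Posz PoszD (erefl _)) DF -natz subrr.
Qed.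

End QuadraticCharacter.

(** * The norm from K[x] / (f) *)

Section PolyNorm.

Variable K : fieldType.
Implicit Types f h : {poly K}.

Definition mulmod_mx d f h : 'M[K]_d := \matrix_(i, j) (h * 'X^i %% f)`_j.

(** The norm from K[x] / (f), which for monic f is the resultant of f and h. As a determinant it is
    multiplicative in h and periodic modulo f. *)
Definition pnorm f h := \det (mulmod_mx (size f).-1 f h).

Lemma pnormE d f h : size f = d.+1 -> pnorm f h = \det (mulmod_mx d f h).
Proof. by rewrite /pnorm => ->. Qed.

Lemma mulmod_mx_row d f h (i : 'I_d) : size f = d.+1 ->
  h * 'X^i %% f = \sum_j mulmod_mx d f h i j *: 'X^j.
Proof.
move=> sf; apply/polyP=> k; rewrite coef_sumMXn big_mkcond /=.
have f0 : f != 0 by rewrite -size_poly_eq0 sf.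
case: (ltnP k d) => kd.
  rewrite (bigD1 (Ordinal kd)) //= eqxx mxE big1 ?addr0 // => j.
  by rewrite -val_eqE /= => /negPf ->.
rewrite big1 => [|j _]; last by rewrite ltn_eqF // (leq_trans (ltn_ord j)).
by rewrite nth_default // (leq_trans _ kd) // -ltnS -sf ltn_modp.
Qed.

Lemma mulmod_mxM d f h1 h2 : size f = d.+1 ->
  mulmod_mx d f (h1 * h2) = mulmod_mx d f h1 *m mulmod_mx d f h2.
Proof.
move=> sf; apply/matrixP=> i k; rewrite !mxE.
rewrite [h1 * h2]mulrC -mulrA -modp_mul (mulmod_mx_row _ _ sf) mulr_sumr.
rewrite (big_morph _ (modpD f) (mod0p f)) coef_sum; apply: eq_bigr => j _.
by rewrite -scalerAr modpZl coefZ !mxE.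
Qed.

Lemma mulmod_mx_mod d f h : mulmod_mx d f (h %% f) = mulmod_mx d f h.
Proof. by apply/matrixP=> i j; rewrite !mxE [_ %% f * _]mulrC modp_mul mulrC. Qed.

Lemma mulmod_mxC d f (c : K) : size f = d.+1 -> mulmod_mx d f c%:P = c%:M.
Proof.
move=> sf; apply/matrixP=> i j; rewrite !mxE mul_polyC modp_small.
  by rewrite coefZ coefXn mulr_natr eq_sym -val_eqE.
by rewrite (leq_ltn_trans (size_scale_leq _ _)) // size_polyXn sf ltnS ltn_ord.
Qed.

Lemma pnormM f h1 h2 : f != 0 -> pnorm f (h1 * h2) = pnorm f h1 * pnorm f h2.
Proof.
by move=> f0; rewrite /pnorm mulmod_mxM ?det_mulmx // prednK // size_poly_gt0.
Qed.

Lemma pnorm_mod f h : pnorm f (h %% f) = pnorm f h.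
Proof. by rewrite /pnorm mulmod_mx_mod. Qed.

Lemma pnormC f (c : K) : f != 0 -> pnorm f c%:P = c ^+ (size f).-1.
Proof.
by move=> f0; rewrite /pnorm mulmod_mxC ?det_scalar // prednK // size_poly_gt0.
Qed.

Lemma pnorm_prod f (I : Type) (s : seq I) (F : I -> {poly K}) : f != 0 ->
  pnorm f (\prod_(i <- s) F i) = \prod_(i <- s) pnorm f (F i).
Proof.
move=> f0; apply: (big_morph _ (fun a b => pnormM a b f0)).
by rewrite pnormC // expr1n.
Qed.

(** Multiplication by X is the companion matrix of f, whose characteristic polynomial is f; the sign
    is that of X - x against x - X. *)
Lemma pnorm_XsubC f x : f \is monic ->
  pnorm f ('X - x%:P) = (-1) ^+ (size f).-1 * f.[x].
Proof.
move=> mf; have f0 := monic_neq0 mf.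
set d := (size f).-1; have sf : size f = d.+1 by rewrite prednK ?size_poly_gt0.
have -> : f.[x] = \det (x%:M - companionmx f).
  rewrite -{1}(companionmxK mf) /char_poly -horner_evalE -det_map_mx.
  congr (\det _); apply/matrixP=> i j.
  rewrite [LHS]mxE [in RHS]mxE [in RHS]mxE [char_poly_mx _ _ _]mxE [in LHS]mxE.
  by rewrite /= /horner_eval !mxE !hornerE hornerMn hornerX.
rewrite -detZ (pnormE _ sf); congr (\det _); apply/matrixP=> i j.
rewrite !mxE mulrBl -exprS modpD modpN coefB.
rewrite [_%:P * _ %% f]modp_small; last first.
  rewrite mul_polyC (leq_ltn_trans (size_scale_leq _ _)) // size_polyXn.
  by rewrite sf ltnS ltn_ord.
rewrite mulN1r opprB mul_polyC coefZ coefXn [j == i :> nat]eq_sym mulr_natr.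
congr (_ - _); rewrite -/d; case: eqP => [Di|/eqP Di]; last first.
  rewrite modp_small; last first.
    rewrite size_polyXn sf !ltnS; have := ltn_ord i; move: Di; lia.
  by rewrite coefXn eq_sym.
have -> : i.+1 = d by have := ltn_ord i; move: Di; lia.
have -> : 'X^d %% f = 'X^d - f.
  rewrite -[X in X %% _](subrK f) modpD modpp addr0 modp_small //.
  rewrite sf ltnS; apply/leq_sizeP => k dk; rewrite coefB coefXn.
  move: dk; rewrite leq_eqVlt => /predU1P[<-|dk].
    by rewrite eqxx -/d -lead_coefE (monicP mf) subrr.
  by rewrite gtn_eqF // nth_default ?subrr // sf.
by rewrite coefB coefXn ltn_eqF ?ltn_ord // sub0r.
Qed.

(** Evaluation at the roots diagonalises multiplication by h; the change of basis [V] is a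
    Vandermonde matrix, invertible since the roots are distinct. *)
Lemma pnorm_prod_XsubC (s : seq K) h : uniq s ->
  pnorm (\prod_(a <- s) ('X - a%:P)) h = \prod_(a <- s) h.[a].
Proof.
set f := \prod_(a <- s) _ => us; pose d := size s.
have sf : size f = d.+1 by rewrite size_prod_XsubC.
pose V : 'M[K]_d := Vandermonde d (\row_j s`_j).
have detV : \det V != 0.
  rewrite det_Vandermonde; apply/prodf_neq0 => i _; apply/prodf_neq0 => j ij.
  by rewrite !mxE subr_eq0 nth_uniq ?ltn_ord // gtn_eqF.
apply: (mulIf detV); rewrite (pnormE _ sf) -det_mulmx.
have -> : mulmod_mx d f h *m V = V *m diag_mx (\row_j h.[s`_j]).
  rewrite mul_mx_diag; apply/matrixP=> i k; rewrite !mxE.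
  have rk : root f s`_k by rewrite root_prod_XsubC mem_nth.
  have := divp_eq (h * 'X^i) f => /(congr1 (horner^~ s`_k)).
  rewrite !hornerE (rootP rk) mulr0 add0r mulrC => ->.
  rewrite (mulmod_mx_row _ _ sf) horner_sum; apply: eq_bigr => j _.
  by rewrite !hornerE !mxE.
rewrite det_mulmx det_diag mulrC; congr (_ * _).
rewrite (big_nth 0) big_mkord; apply: eq_bigr => i _; by rewrite mxE.
Qed.

End PolyNorm.

Lemma pnorm_map (K L : fieldType) (iota : {rmorphism K -> L}) (f h : {poly K}) :
  pnorm (map_poly iota f) (map_poly iota h) = iota (pnorm f h).
Proof.
rewrite -det_map_mx /pnorm size_map_poly; congr (\det _).
apply/matrixP=> i j.
by rewrite !mxE -[in RHS]coef_map /= map_modp rmorphM /= map_polyXn.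
Qed.

(** * Euler products over monic polynomials *)

Section MonicPolynomials.

Variable F : finFieldType.
Implicit Types h D P : {poly F}.

Definition monics n : seq {poly F} :=
  [seq 'X^n + polyn v | v <- enum [set: {poly_n F}]].

Lemma mem_monics n h : (h \in monics n) = (h \is monic) && (size h == n.+1).
Proof.
apply/mapP/andP=> [[v _ ->]|[mh /eqP sh]].
  have sv : (size v < size ('X^n : {poly F}))%N by rewrite size_polyXn ltnS size_npoly.
  by rewrite size_polyDl // size_polyXn eqxx monicE lead_coefDl // lead_coefXn.
have sv : (size (h - 'X^n)%R <= n)%N.
  apply/leq_sizeP=> k; rewrite leq_eqVlt coefB coefXn => /predU1P[<-|nk].
    by have /monicP := mh; rewrite lead_coefE sh /= => ->; rewrite eqxx subrr.
  by rewrite gtn_eqF // nth_default ?subrr // sh.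
by exists (NPoly sv); rewrite ?mem_enum ?inE //= addrC subrK.
Qed.

Lemma monics_uniq n : uniq (monics n).
Proof. by rewrite map_inj_uniq ?enum_uniq // => u v /addrI /val_inj. Qed.

Lemma monics0 : monics 0 = [:: 1].
Proof.
suffices /perm_small_eq : perm_eq (monics 0) [:: 1] by exact.
apply: uniq_perm; rewrite ?monics_uniq // => h; rewrite mem_monics inE.
apply/andP/eqP => [[mh /eqP sh]|->]; last by rewrite monic1 size_poly1.
have [c _ Dh] := size_poly1P _ (introT eqP sh).
by move: mh; rewrite Dh monicE lead_coefC => /eqP->.
Qed.

Lemma big_monics_dvd (R : nmodType) n r D (G : {poly F} -> R) :
    D \in monics r -> (r <= n)%N ->
  \sum_(h <- monics n | D %| h) G h = \sum_(h <- monics (n - r)) G (D * h).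
Proof.
rewrite mem_monics => /andP[mD /eqP sD] rn; have D0 := monic_neq0 mD.
rewrite -big_filter -(big_map (fun h => D * h) predT G); apply: perm_big.
apply: uniq_perm; rewrite ?filter_uniq ?monics_uniq //.
  by rewrite map_inj_uniq ?monics_uniq //; apply: mulfI.
move=> h; rewrite mem_filter mem_monics; apply/and3P/mapP => [[Dh mh /eqP sh]|].
  exists (h %/ D); last by rewrite mulrC divpK.
  rewrite mem_monics size_divp // sh sD /= subSn // eqxx andbT.
  by rewrite -(monicMr _ mD) divpK.
case=> h'; rewrite mem_monics => /andP[mh' /eqP sh'] ->; split.
- exact: dvdp_mulr.
- by rewrite monicMl.
- by rewrite size_mul ?(monic_neq0 mh') // sD sh' addSn /= addnS subnKC.
Qed.

Definition irrs N : seq {poly F} :=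
  [seq P <- flatten [seq monics e | e <- iota 1 N] | irreducibleb P].

Lemma mem_irrs N P : reflect
  [/\ P \is monic, irreducible_poly P & ((size P).-1 <= N)%N] (P \in irrs N).
Proof.
rewrite mem_filter; apply: (iffP andP) => [[/irreducibleP irrP]|[mP irrP sP]].
  move=> /flattenP[s /mapP[e]]; rewrite mem_iota => /andP[_ eN] ->.
  by rewrite mem_monics => /andP[mP /eqP->]; split; rewrite //= -ltnS -add1n.
split; first exact/irreducibleP.
have [P1 _] := irrP; apply/flattenP; exists (monics (size P).-1).
  apply/mapP; exists (size P).-1; rewrite // mem_iota.
  by move: P1 sP; case: (size P) => [|[|k]].
by rewrite mem_monics mP prednK ?eqxx // ltnW.
Qed.

Lemma irrs_uniq N : uniq (irrs N).
Proof.
apply: filter_uniq; elim: N 1%N => //= N IH m; rewrite cat_uniq monics_uniq IH andbT.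
apply/hasPn=> P /flattenP[s /mapP[e]]; rewrite mem_iota => /andP[me _] ->.
rewrite !mem_monics => /andP[mP /eqP->]; rewrite eqSS; apply/negP=> /andP[_].
by move: me; lia.
Qed.

Lemma irreducible_divisor h : (1 < size h)%N ->
  exists P, [/\ P \is monic, irreducible_poly P & P %| h].
Proof.
move: {2}(size h) (leqnn (size h)) => n; elim: n h => [|n IH] h hn h1.
  by move: h1; rewrite ltnNge (leq_trans hn).
have h0 : h != 0 by rewrite -size_poly_gt0 ltnW.
have lc0 : lead_coef h != 0 by rewrite lead_coef_eq0.
have [/irreducibleP irrh|] := boolP (irreducibleb h).
  exists ((lead_coef h)^-1 *: h); split; last by rewrite dvdpZl ?invr_eq0.
    by rewrite monicE lead_coefZ mulVf.
  have [_ irr] := irrh; split; first by rewrite size_scale ?invr_eq0.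
  move=> q q1; rewrite dvdpZr ?invr_eq0 // => /(irr _ q1) /eqp_trans-> //.
  by rewrite eqp_sym eqp_scale // invr_eq0.
rewrite /irreducibleb h1 /= => /forallPn[q]; rewrite negb_imply -ltnNge.
rewrite -Pdiv.Idomain.dvdpE => /andP[qh q1].
have [] := IH q _ q1; last by move=> P [mP iP Pq]; exists P; split=> //; apply: dvdp_trans qh.
by apply: leq_trans (size_npoly q) _; rewrite -subn1 leq_subLR add1n.
Qed.

Lemma irreducible_dvd_monic P Q : P \is monic -> irreducible_poly P ->
  Q \is monic -> irreducible_poly Q -> P %| Q -> P = Q.
Proof.
move=> mP [P1 _] mQ [_ iQ] PQ; apply/eqP; rewrite -eqp_monic //; apply: iQ => //.
by rewrite gtn_eqF.
Qed.

(** The polynomial analogue of log n as the sum of the von Mangoldt function over the divisors of n.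
    The induction removes one irreducible factor [Q], which only changes the terms of [Q]. *)
Lemma sum_irreducible_powers h N : h \is monic -> ((size h).-1 <= N)%N ->
  (\sum_(P <- irrs N) \sum_(1 <= k < N.+1 | (P ^+ k %| h)%R) (size P).-1
    = (size h).-1)%N.
Proof.
move: {2}(size h) (leqnn (size h)) => n; elim: n h => [|n IH] h hn mh hN.
  by move: hn; rewrite leqNgt size_poly_gt0 monic_neq0.
have [h1|h1] := leqP (size h) 1.
  have -> : h = 1.
    have [c Dh] : exists c, h = c%:P by exists h`_0; apply: size1_polyC.
    by move: mh; rewrite Dh monicE lead_coefC => /eqP->.
  rewrite size_poly1 big_seq big1 // => P /mem_irrs[mP [P1 _] _].
  rewrite big_nat_cond big1 // => k /andP[/andP[k1 _]].
  rewrite dvdp1 => /eqP Pk1; have /esym/eqP := size_exp P k.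
  by rewrite Pk1 muln_eq0 (gtn_eqF k1) orbF => /eqP.
have [Q [mQ iQ Qh]] := irreducible_divisor h1; have [Q1 _] := iQ.
pose h' : {poly F} := h %/ Q; have Dh : h = Q * h' by rewrite mulrC divpK.
have mh' : h' \is monic by rewrite -(monicMl _ mQ) -Dh.
have Q0 := monic_neq0 mQ; have h'0 := monic_neq0 mh'.
have sh : ((size h).-1 = (size Q).-1 + (size h').-1)%N.
  rewrite Dh size_mul // -[size Q]prednK ?size_poly_gt0 //.
  by rewrite -[size h']prednK ?size_poly_gt0 //= addnS.
have Q_N : Q \in irrs N.
  by apply/mem_irrs; split=> //; apply: leq_trans hN; rewrite sh leq_addr.
have N0 : (0 < N)%N by move: hN Q1; rewrite sh; lia.
rewrite sh -(IH h') //; first last.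
- by apply: leq_trans hN; rewrite sh leq_addl.
- by move: sh hn Q1; move: (size h) (size Q) (size h') => a b c; lia.
rewrite !(bigD1_seq Q) ?irrs_uniq //= addnA; congr (_ + _)%N; last first.
  rewrite big_seq_cond [RHS]big_seq_cond; apply: eq_bigr => P.
  move=> /andP[/mem_irrs[mP iP _] PQ]; apply: eq_bigl => k.
  rewrite Dh Gauss_dvdpr // coprimep_expl // irreducible_poly_coprime //.
  by apply: contra PQ => /(irreducible_dvd_monic mP iP mQ iQ)->.
rewrite big_add1 /= big_mkcond big_ltn // expr1 Dh dvdp_mulr //=.
congr (_ + _)%N; rewrite [RHS]big_mkcond [RHS]big_nat_recr //=.
rewrite [X in (_ + X)%N]ifF ?addn0; last first.
  apply/negP=> /(dvdp_leq h'0); have := size_exp Q N; move: sh hN Q1.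
  move: (size h) (size Q) (size h') (size (Q ^+ N)) => a b c e.
  by case: b => [|[|b]] //=; nia.
by apply: eq_bigr => k _; rewrite exprS dvdp_mul2l.
Qed.

End MonicPolynomials.

Lemma sum_multiples (R : nmodType) n e (G : nat -> nat -> R) : (0 < e)%N ->
  \sum_(1 <= k < n.+1 | (e * k <= n)%N) G (e * k)%N k =
  \sum_(1 <= r < n.+1 | (e %| r)%N) G r (r %/ e)%N.
Proof.
move=> e0; rewrite -big_filter -[RHS]big_filter.
have -> : \sum_(k <- [seq k <- index_iota 1 n.+1 | (e * k <= n)%N]) G (e * k)%N k =
    \sum_(r <- [seq (e * k)%N | k <- [seq k <- index_iota 1 n.+1 | (e * k <= n)%N]])
       G r (r %/ e)%N.
  by rewrite big_map; apply: eq_bigr => k _; rewrite mulKn.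
apply: perm_big; apply: uniq_perm.
- rewrite map_inj_uniq ?filter_uniq ?iota_uniq // => x y /eqP.
  by rewrite eqn_pmul2l // => /eqP.
- by rewrite filter_uniq ?iota_uniq.
move=> r; rewrite mem_filter mem_index_iota; apply/mapP/and3P => [[k]|].
  rewrite mem_filter mem_index_iota => /and3P[ekn k1 _] ->.
  by rewrite dvdn_mulr // muln_gt0 e0 k1 ltnS.
case=> er r1 rn; exists (r %/ e)%N; last by rewrite mulnC divnK.
rewrite mem_filter mem_index_iota mulnC divnK // -ltnS rn divn_gt0 //.
by rewrite dvdn_leq // ltnS (leq_trans (leq_div _ _)).
Qed.

Section LogarithmicDerivative.

Variables (F : finFieldType) (R : comNzRingType) (chi : {poly F} -> R).
Hypothesis chi1 : chi 1 = 1.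
Hypothesis chiM : forall P h, P \is monic -> h \is monic -> chi (P * h) = chi P * chi h.

Definition Lcoef n := \sum_(h <- monics F n) chi h.

(** The coefficient of T^r in T L'/L for the Euler product L of [chi] restricted to irreducibles of
    degree at most N; nothing is lost when 0 < r <= N. *)
Definition Lpower N r := \sum_(P <- irrs F N | ((size P).-1 %| r)%N)
  chi P ^+ (r %/ (size P).-1) *+ (size P).-1.

Lemma Lcoef0 : Lcoef 0 = 1.
Proof. by rewrite /Lcoef monics0 big_seq1. Qed.

(* Comparing the two ways of counting degrees in [\sum_h chi h] gives the
   logarithmic derivative of the Euler product. *)
Lemma Lcoef_rec n :
  Lcoef n *+ n = \sum_(1 <= r < n.+1) Lpower n r * Lcoef (n - r).
Proof.
have chiX P k : P \is monic -> chi (P ^+ k) = chi P ^+ k.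
  by move=> mP; elim: k => // k IH; rewrite !exprS chiM ?monic_exp // IH.
transitivity (\sum_(h <- monics F n) \sum_(P <- irrs F n)
    \sum_(1 <= k < n.+1 | P ^+ k %| h) chi h *+ (size P).-1).
  rewrite -sumrMnl big_seq [RHS]big_seq; apply: eq_bigr => h.
  rewrite mem_monics => /andP[mh /eqP sh].
  rewrite -{1}[n]/(n.+1.-1) -sh -(sum_irreducible_powers (N := n)) ?sh //.
  rewrite -sumrMnr; apply: eq_bigr => P _.
  by rewrite -sumrMnr.
under [RHS]eq_bigr => r _ do rewrite mulr_suml.
rewrite exchange_big [RHS](exchange_big_dep predT) //= big_seq [RHS]big_seq.
apply: eq_bigr => P /mem_irrs[mP [P1 _] _]; set e := (size P).-1.
have e0 : (0 < e)%N by rewrite /e; case: (size P) P1 => [|[|]].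
rewrite (exchange_big_dep predT) //=.
pose G r k := chi P ^+ k *+ e * Lcoef (n - r).
rewrite -(sum_multiples _ G) // [RHS]big_mkcond /=; apply: eq_bigr => k _.
have PkM : P ^+ k \in monics F (e * k).
  rewrite mem_monics monic_exp //= /e -size_exp prednK // lt0n size_poly_eq0.
  by rewrite monic_neq0 ?monic_exp.
case: leqP => ekn; last first.
  rewrite big_seq_cond big1 // => h; rewrite mem_monics => /andP[/andP[mh /eqP sh]].
  move/(dvdp_leq (monic_neq0 mh)); rewrite sh leqNgt.
  by move: PkM; rewrite mem_monics => /andP[_ /eqP->]; rewrite ltnS ekn.
rewrite (big_monics_dvd _ PkM) // /G /Lcoef mulr_sumr big_seq [RHS]big_seq.
apply: eq_bigr => h; rewrite mem_monics => /andP[mh _].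
by rewrite chiM ?monic_exp // chiX // mulrnAl.
Qed.

Lemma Lpower_le N r : (0 < r <= N)%N -> Lpower N r = Lpower r r.
Proof.
case/andP=> r0 rN; rewrite /Lpower -big_filter -[RHS]big_filter; apply: perm_big.
apply: uniq_perm => [||P]; [exact/filter_uniq/irrs_uniq..|].
rewrite ![_ \in filter (fun i => _ %| r)%N _]mem_filter.
apply/andP/andP => -[Pr /mem_irrs[mP iP sP]]; split=> //.
  by apply/mem_irrs; split=> //; apply: dvdn_leq.
by apply/mem_irrs; split=> //; apply: leq_trans rN.
Qed.

End LogarithmicDerivative.

(** * Roots of irreducible polynomials in finite extensions *)

Lemma irreducible_dvd_root (F E : fieldType) (phi : {rmorphism F -> E})
    (P h : {poly F}) x :
  irreducible_poly P -> root (map_poly phi P) x ->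
  (P %| h) = root (map_poly phi h) x.
Proof.
move=> iP rP; apply/idP/idP => [/dvdpP[u ->]|rh].
  by rewrite rmorphM rootM rP orbT.
apply/negPn/negP=> nPh; have := irreducible_poly_coprime h iP.
rewrite nPh -(coprimep_map phi) => /coprimep_root/(_ rP).
by rewrite (rootP rh) eqxx.
Qed.

Lemma expp_morph (R : comNzRingType) p m : p \in [pchar R] ->
  {morph (fun z : R => z ^+ (p ^ m)) : z t / z + t}.
Proof.
move=> pR; elim: m => [|m IHm] z t; first by rewrite expn0 !expr1.
by rewrite expnSr !exprM IHm -!(pFrobenius_autE pR) rmorphD.
Qed.

Section FrobeniusRoots.

Variables (F E : finFieldType) (phi : {rmorphism F -> E}).
Let q := #|F|.

Lemma exp_card_morph n : {morph (fun x : E => x ^+ (q ^ n)) : x y / x + y}.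
Proof.
have [p p_pr pF] := finPcharP F; have pE : p \in [pchar E] by rewrite (fmorph_pchar phi).
have qp : exists k, q = (p ^ k)%N.
  by exists (logn p #|F|); have := card_pprimeChar pF.
case: qp => k Dq x y.
by rewrite Dq -expnM (expp_morph _ pE).
Qed.

Lemma horner_exp_card n (h : {poly F}) x :
  (map_poly phi h).[x] ^+ (q ^ n) = (map_poly phi h).[x ^+ (q ^ n)].
Proof.
have cX (c : F) : c ^+ (q ^ n) = c.
  by elim: n => [|n IH]; rewrite ?expr1 // expnS exprM expf_card.
elim/poly_ind: h => [|h c IH]; first by
  rewrite rmorph0 !horner0 expr0n gtn_eqF // expn_gt0 /q (cardD1 0).
rewrite rmorphD rmorphM /= map_polyX map_polyC !hornerE exp_card_morph exprMn IH.
by rewrite -[in LHS]rmorphXn /= cX.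
Qed.

End FrobeniusRoots.

(** The field is F[x] / (P). By the last clause, a power of Frobenius that fixes the class of x
    fixes everything. *)
Lemma irreducible_root_field (F : finFieldType) (P : {poly F}) :
    P \is monic -> irreducible_poly P ->
  exists (Q : finFieldType) (phi : {rmorphism F -> Q}) (x : Q),
    [/\ #|Q| = (#|F| ^ (size P).-1)%N, root (map_poly phi P) x
      & forall y, exists h, y = (map_poly phi h).[x]].
Proof.
move=> mP iP; pose hI : monic_irreducible_poly P := (iP, mP).
have mkP : mk_monic P = P by apply: mk_monicE.
exists {poly %/ P with hI}, (qpolyC P : {rmorphism F -> {poly %/ P}}), (in_qpoly P 'X).
split; first exact: card_qfpoly.
  rewrite /root -in_qpoly_comp_horner comp_polyXr; apply/eqP/val_inj.
  by rewrite /= mkP -Pdiv.IdomainMonic.modpE // modpp.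
move=> y; exists (polyn y); rewrite -in_qpoly_comp_horner comp_polyXr.
by apply/esym/val_inj; apply: in_qpoly_small; apply: size_mk_monic.
Qed.

Lemma irreducible_dvd_Xq (F : finFieldType) (P : {poly F}) k :
    P \is monic -> irreducible_poly P ->
  (P %| 'X^(#|F| ^ k) - 'X) = ((size P).-1 %| k)%N.
Proof.
move=> mP iP; have [Q [phi [x [cQ rx Qx]]]] := irreducible_root_field mP iP.
have F1 := finNzRing_gt1 F.
rewrite (irreducible_dvd_root _ iP rx) rmorphB /= map_polyXn map_polyX /root.
rewrite !hornerE subr_eq0; set e := (size P).-1.
have xe a : x ^+ (#|F| ^ (a * e)) = x.
  elim: a => // a IH; rewrite mulSn expnD exprM -cQ expf_card //.
have [P1 _] := iP; have e0 : (0 < e)%N by rewrite /e; case: (size P) P1 => [|[]].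
rewrite /dvdn {1}(divn_eq k e) expnD exprM xe; case: posnP => [->|m0].
  by rewrite expr1 eqxx.
(* With m = k mod e and 0 < m < e, all q^e elements of [Q] would be roots of X^(q^m) - X, which is
   too many. *)
apply/negP=> /eqP xm; have ym (y : Q) : y ^+ (#|F| ^ (k %% e)) = y.
  by have [h ->] := Qx y; rewrite horner_exp_card xm.
have m1 : (1 < #|F| ^ (k %% e))%N by rewrite -(expn0 #|F|) ltn_exp2l.
have sX : size ('X^(#|F| ^ (k %% e)) - 'X : {poly Q}) = (#|F| ^ (k %% e)).+1.
  by rewrite size_polyDl ?size_polyXn // size_polyN size_polyX.
have /max_poly_roots/(_ _ (enum_uniq _)) : ('X^(#|F| ^ (k %% e)) - 'X : {poly Q}) != 0.
  by rewrite -size_poly_eq0 sX.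
move/(_ Q); rewrite sX -cardE cQ ltnS leq_exp2l // leqNgt ltn_mod e0 /=.
by move=> H; apply/notF/H; apply/allP=> y _; rewrite /root !hornerE ym subrr.
Qed.

Section RootsInExtension.

Variables (F E : finFieldType) (phi : {rmorphism F -> E}) (r : nat).
Hypothesis r0 : (0 < r)%N.
Hypothesis cE : #|E| = (#|F| ^ r)%N.

Lemma irreducible_root_degree P x : P \is monic -> irreducible_poly P ->
  root (map_poly phi P) x -> ((size P).-1 %| r)%N.
Proof.
move=> mP iP rx; rewrite -(irreducible_dvd_Xq _ mP iP) (irreducible_dvd_root _ iP rx).
by rewrite rmorphB /= map_polyXn map_polyX /root !hornerE -cE expf_card subrr.
Qed.

(** The Frobenius conjugates of x are roots, and by [irreducible_dvd_Xq] the first deg P of them are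
    distinct, so there are no others. *)
Lemma irreducible_roots P x : P \is monic -> irreducible_poly P ->
    root (map_poly phi P) x ->
  let s := [seq x ^+ (#|F| ^ i) | i <- iota 0 (size P).-1] in
  uniq s /\ map_poly phi P = \prod_(a <- s) ('X - a%:P).
Proof.
move=> mP iP rx s; set e := (size P).-1 in s *; have [P1 _] := iP.
have inj n (y z : E) : y ^+ (#|F| ^ n) = z ^+ (#|F| ^ n) -> y = z.
  have := exp_card_morph phi n (y - z) z; rewrite subrK => -> /(canRL (addrK _)).
  by rewrite subrr => /eqP; rewrite expf_eq0 => /andP[_]; rewrite subr_eq0 => /eqP.
have us : uniq s.
  rewrite map_inj_in_uniq ?iota_uniq // => i j; rewrite !mem_iota !add0n /=.
  wlog ij : i j / (i <= j)%N.
    move=> W ie je xij; case/orP: (leq_total i j) => ij; first exact: W.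
    by apply/esym; apply: W.
  move=> ie je; rewrite -{1}(subnK ij) expnD exprM => /inj/esym/eqP.
  have := irreducible_dvd_Xq (j - i) mP iP; rewrite (irreducible_dvd_root _ iP rx).
  rewrite rmorphB /= map_polyXn map_polyX /root !hornerE subr_eq0 => -> /dvdnP[k].
  by rewrite -/e; clear r0 cE; case: k => [|k]; move: ij je; nia.
split=> //; have sP : size (map_poly phi P) = (size s).+1.
  by rewrite size_map_poly size_map size_iota prednK // ltnW.
rewrite [LHS](all_roots_prod_XsubC sP) ?uniq_rootsE //.
  by rewrite lead_coef_map (monicP mP) rmorph1 scale1r.
apply/allP=> _ /mapP[i _ ->]; rewrite /root -horner_exp_card (rootP rx).
by rewrite expr0n gtn_eqF // expn_gt0 (cardD1 0).
Qed.

Lemma card_irreducible_roots P : P \is monic -> irreducible_poly P ->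
  #|[set x | root (map_poly phi P) x]| =
    (if ((size P).-1 %| r)%N then (size P).-1 else 0%N).
Proof.
move=> mP iP; case: ifP => Pr; last first.
  apply/eqP; rewrite cards_eq0; apply/eqP/setP=> x; rewrite !inE.
  by apply: contraFF Pr; apply: irreducible_root_degree.
have [x rx] : exists x, root (map_poly phi P) x.
  have := Pr; rewrite -(irreducible_dvd_Xq _ mP iP) -(dvdp_map phi) rmorphB /=.
  rewrite map_polyXn map_polyX -cE finField_genPoly => /dvdp_prod_XsubC[m].
  set s := mask _ _ => eqs; have [P1 _] := iP; have := eqp_size eqs.
  rewrite size_map_poly size_prod_XsubC; case Ds : s => [|x s'] sP.
    by rewrite sP in P1.
  by exists x; rewrite (eqp_root eqs) Ds root_prod_XsubC mem_head.
have [us DP] := irreducible_roots mP iP rx; rewrite DP.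
set s := map _ _ in us *; transitivity #|s|.
  by apply: eq_card => y; rewrite inE root_prod_XsubC.
by rewrite (card_uniqP us) size_map size_iota.
Qed.

(** Each element of E is a root of exactly one monic irreducible polynomial, of degree dividing r,
    and each of these has as many roots as its degree. This turns sums over points into [Lpower]. *)
Lemma sum_over_roots (R : nmodType) (G : E -> R) (H : {poly F} -> R) :
    (forall P x, P \is monic -> irreducible_poly P ->
       root (map_poly phi P) x -> G x = H P) ->
  \sum_x G x = \sum_(P <- irrs F r | ((size P).-1 %| r)%N) H P *+ (size P).-1.
Proof.
move=> GH; have exP (h : {poly F}) x : h != 0 -> root (map_poly phi h) x ->
    exists P, [/\ P \is monic, irreducible_poly P & root (map_poly phi P) x].
  move: {2}(size h) (leqnn (size h)) => n; elim: n h => [|n IH] h hn h0 rh.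
    by move: hn; rewrite leqNgt size_poly_gt0 h0.
  have h1 : (1 < size h)%N by rewrite -(size_map_poly phi) (root_size_gt1 _ rh) // map_poly_eq0.
  have [P [mP iP Ph]] := irreducible_divisor h1; have [P1 _] := iP.
  have := rh; rewrite -(divpK Ph) rmorphM rootM => /orP[rx|rx]; last by exists P.
  have hP0 : h %/ P != 0 by rewrite dvdp_div_eq0.
  apply: (IH (h %/ P)) => //; rewrite size_divp ?monic_neq0 //.
  by move: hn P1 h1; move: (size h) (size P) => a b; lia.
transitivity (\sum_x \sum_(P <- irrs F r | root (map_poly phi P) x) G x).
  apply: eq_bigr => x _; have X0 : 'X^#|E| - 'X != 0 :> {poly F}.
    rewrite -size_poly_eq0 size_polyDl ?size_polyXn // size_polyN size_polyX.
    by rewrite ltnS finNzRing_gt1.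
  have [|P [mP iP rx]] := exP _ x X0.
    by rewrite rmorphB /= map_polyXn map_polyX /root !hornerE expf_card subrr.
  have Pr : P \in irrs F r.
    by apply/mem_irrs; split=> //; apply: dvdn_leq => //; apply: irreducible_root_degree rx.
  rewrite -big_filter (perm_big [:: P]) ?big_seq1 //; apply: uniq_perm => // [|P'].
    exact/filter_uniq/irrs_uniq.
  rewrite [LHS](mem_filter (fun P => root _ x)) inE; apply/andP/eqP => [[rx']|->//].
  case/mem_irrs=> mP' iP' _; apply/esym/(irreducible_dvd_monic mP iP mP' iP').
  by rewrite (irreducible_dvd_root _ iP rx).
rewrite (exchange_big_dep predT) //= [RHS]big_mkcond big_seq [RHS]big_seq.
apply: eq_bigr => P /mem_irrs[mP iP _].
rewrite (eq_bigr (fun=> H P)) => [|x rx]; last exact: GH rx.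
rewrite sumr_const -cardsE (_ : [set x | _] = [set x | root (map_poly phi P) x]).
  by rewrite card_irreducible_roots //; case: ifP.
by apply/setP=> x; rewrite !inE.
Qed.

End RootsInExtension.

(** * The residue symbol and its L-function *)

Section PolynomialCharacter.

Variables (F : finFieldType) (f : {poly F}).
Hypothesis mf : f \is monic.

(** The Jacobi symbol (h / f). It is periodic modulo f, which the functional equation needs, while
    point counts lead to (f / h), that is [lchar]. *)
Definition rchar h := qchar (pnorm f h).

(* The sign turns the resultant of [f] and [h] into that of [h] and [f], i.e.
   into the product of the values of [f] at the roots of [h]. *)
Definition lchar (h : {poly F}) := qchar ((-1) ^+ ((size f).-1 * (size h).-1) * pnorm f h).

Hypothesis oddF : odd #|F|.

Lemma rcharM h1 h2 : rchar (h1 * h2) = rchar h1 * rchar h2.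
Proof. by rewrite /rchar pnormM ?monic_neq0 // qcharM. Qed.

Lemma rchar1 : rchar 1 = 1.
Proof. by rewrite /rchar pnormC ?monic_neq0 // expr1n qchar1. Qed.

Lemma rcharC c : rchar c%:P = qchar c ^+ (size f).-1.
Proof. by rewrite /rchar pnormC ?monic_neq0 // qcharX. Qed.

Lemma rchar_mod h : rchar (h %% f) = rchar h.
Proof. by rewrite /rchar pnorm_mod. Qed.

Lemma lcharE h : lchar h = qchar (-1 : F) ^+ ((size f).-1 * (size h).-1) * rchar h.
Proof. by rewrite /lchar qcharM // qcharX. Qed.

Lemma lchar1 : lchar 1 = 1.
Proof. by rewrite lcharE size_poly1 muln0 mul1r rchar1. Qed.

Lemma lcharM h1 h2 : h1 \is monic -> h2 \is monic ->
  lchar (h1 * h2) = lchar h1 * lchar h2.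
Proof.
move=> m1 m2; rewrite !lcharE rcharM size_mul ?monic_neq0 //.
rewrite -[size h1]prednK ?size_poly_gt0 ?monic_neq0 //.
rewrite -[size h2]prednK ?size_poly_gt0 ?monic_neq0 //=.
by rewrite addnS /= mulnDr exprD; ring.
Qed.

Variables (E : finFieldType) (phi : {rmorphism F -> E}) (r : nat).
Hypothesis r0 : (0 < r)%N.
Hypothesis cE : #|E| = (#|F| ^ r)%N.

Lemma odd_card_ext : odd #|E|.
Proof. by rewrite cE oddX oddF orbT. Qed.

(** Since (q^r - 1)/2 = (1 + q + ... + q^(r-1)) (q - 1)/2, the symbol of f(x) in E is that of its
    norm to F. This norm is the product of f over the conjugates of x, to the power r / deg P. *)
Lemma qchar_at_root P x : P \is monic -> irreducible_poly P ->
    root (map_poly phi P) x ->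
  qchar (map_poly phi f).[x] = lchar P ^+ (r %/ (size P).-1).
Proof.
move=> mP iP rx; have oddE := odd_card_ext.
have [us DP] := irreducible_roots mP iP rx; set e := (size P).-1 in us DP *.
have Pr : (e %| r)%N := irreducible_root_degree cE mP iP rx.
pose fE := map_poly phi f; pose u := (-1) ^+ ((size f).-1 * e) * pnorm f P.
have Du : phi u = \prod_(0 <= i < e) fE.[x ^+ (#|F| ^ i)].
  rewrite rmorphM rmorphXn rmorphN1 /= -pnorm_map DP pnorm_prod; last first.
    by rewrite map_poly_eq0 monic_neq0.
  under eq_bigr => a _ do rewrite pnorm_XsubC ?map_monic // size_map_poly.
  rewrite big_split /= big_map big_const_seq iter_mulr_1 count_predT size_iota -exprM.
  rewrite mulrA -exprMn mulrNN mulr1 expr1n mul1r big_map.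
  by rewrite /index_iota subn0.
have DE : (#|E|./2 = (\sum_(i < r) #|F| ^ i) * #|F|./2)%N.
  apply/double_inj; rewrite card_half_double // cE predn_exp doubleMr.
  by rewrite card_half_double // mulnC.
have prodr : fE.[x] ^+ (\sum_(i < r) #|F| ^ i) = phi u ^+ (r %/ e).
  rewrite expr_sum -(big_mkord predT (fun i => fE.[x] ^+ (#|F| ^ i))).
  rewrite -{1}(divnK Pr); elim: (r %/ e)%N => [|k IH].
    by rewrite mul0n big_geq.
  rewrite mulSnr (@big_cat_nat _ _ _ (k * e)) ?leq_addr //= IH exprSr; congr (_ * _).
  rewrite Du -{1}[(k * e)%N]add0n big_addn addKn.
  apply: eq_bigr => i _; rewrite horner_exp_card addnC expnD exprM.
  congr (_.[_ ^+ _]); have [P1 _] := iP.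
  have := irreducible_dvd_Xq (k * e) mP iP; rewrite dvdn_mull //.
  rewrite (irreducible_dvd_root _ iP rx) rmorphB /= map_polyXn map_polyX /root.
  by rewrite !hornerE subr_eq0 => /eqP.
apply: (sign_int_inj oddE); first exact: qchar_val.
  rewrite /lchar -/u; case/or3P: (qchar_val u) => /eqP->; rewrite ?expr1n //.
    by case: (r %/ e)%N => [|k]; rewrite ?expr0 ?exprS ?mul0r.
  by rewrite -signr_odd; case: odd.
rewrite qchar_exp // rmorphXn /= /lchar -/u DE exprM prodr (qchar_root oddF phi u).
by rewrite -!exprM mulnC.
Qed.

Lemma sum_qchar_horner :
  \sum_x qchar (map_poly phi f).[x] = Lpower lchar r r.
Proof.
by apply: (sum_over_roots r0 cE (phi := phi)) => P x mP iP rx; apply: qchar_at_root.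
Qed.

End PolynomialCharacter.

(** Over a splitting field all three norms are products of values of h, and separability makes the
    roots of [f1] and [f2] distinct. *)
Lemma pnorm_mul (F : finFieldType) (f1 f2 h : {poly F}) :
    f1 \is monic -> f2 \is monic -> separable_poly (f1 * f2) ->
  pnorm (f1 * f2) h = pnorm f1 h * pnorm f2 h.
Proof.
move=> m1 m2 sep; have f0 : f1 * f2 != 0 by rewrite mulf_neq0 ?monic_neq0.
have [L [s Ds _]] := FinSplittingFieldFor f0.
set phi := in_alg L in Ds; have split (e : {poly F}) : e \is monic -> e %| f1 * f2 ->
    exists t, map_poly phi e = \prod_(a <- t) ('X - a%:P).
  move=> me; rewrite -(dvdp_map phi) (eqp_dvdr _ Ds) => /dvdp_prod_XsubC[m Dm].
  exists (mask m s); apply/eqP; rewrite -eqp_monic ?map_monic //.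
  exact: monic_prod_XsubC.
have [s1 D1] := split _ m1 (dvdp_mulr _ (dvdpp _)).
have [s2 D2] := split _ m2 (dvdp_mull _ (dvdpp _)).
have D12 : map_poly phi (f1 * f2) = \prod_(a <- s1 ++ s2) ('X - a%:P).
  by rewrite rmorphM big_cat /= D1 D2.
have : uniq (s1 ++ s2) by rewrite -separable_prod_XsubC -D12 separable_map.
move=> u12; have := u12; rewrite cat_uniq => /and3P[u1 _ u2].
apply: (fmorph_inj phi); rewrite rmorphM -!pnorm_map D12 D1 D2.
by rewrite !pnorm_prod_XsubC // big_cat.
Qed.

(** The norm of F[x] / (P) is y -> y^(1 + q + ... + q^(e-1)), so the symbol is the quadratic
    character of that field, and [v] represents a non-residue. *)
Lemma rchar_irreducible_exists (F : finFieldType) (P : {poly F}) :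
    odd #|F| -> P \is monic -> irreducible_poly P ->
  exists v, rchar P v = -1.
Proof.
move=> oddF mP iP; have [Q [phi [x [cQ rx Qx]]]] := irreducible_root_field mP iP.
set e := (size P).-1 in cQ; have oddQ : odd #|Q| by rewrite cQ oddX oddF orbT.
have [us DP] := irreducible_roots mP iP rx; rewrite -/e in us DP.
have [y Dy] := qchar_exists oddQ; have [v Dv] := Qx y; exists v.
apply: (sign_int_inj oddQ) => //; first exact: qchar_val.
rewrite (qchar_root oddF phi) -pnorm_map DP pnorm_prod_XsubC // big_map.
under eq_bigr => i _ do rewrite -horner_exp_card -Dv.
rewrite -[e in iota 0 e]subn0 -/(index_iota 0 e) big_mkord -expr_sum -exprM.
rewrite -Dy qchar_exp //; congr (_ ^+ _); apply/double_inj.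
by rewrite card_half_double // cQ predn_exp doubleMr card_half_double // mulnC.
Qed.

Section ResidueCharacter.

Variables (F : finFieldType) (f : {poly F}) (d : nat).
Implicit Types (a b u h : {poly F}) (w : F -> int).
Hypothesis oddF : odd #|F|.
Hypothesis mf : f \is monic.
Hypothesis sf : size f = d.+1.
Hypothesis d0 : (0 < d)%N.
Hypothesis sepf : separable_poly f.
Let q := #|F|.
Let f0 : f != 0 := monic_neq0 mf.

(* [u] is 1 modulo f / P and a non-residue modulo P, for a common irreducible
   factor P of f and b. *)
Lemma rchar_primitive b : ~~ coprimep f b ->
  exists2 u, rchar f u = -1 & (u * b) %% f = b %% f.
Proof.
move=> nfb; pose D := gcdp f b.
have D0 : D != 0 by rewrite gcdp_eq0 (negPf f0).
have D1 : (1 < size D)%N.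
  by rewrite ltn_neqAle size_poly_gt0 D0 andbT eq_sym.
have [P [mP iP PD]] := irreducible_divisor D1.
have /dvdpP[f1 Df] : P %| f by apply: dvdp_trans PD (dvdp_gcdl _ _).
have /dvdpP[b1 Db] : P %| b by apply: dvdp_trans PD (dvdp_gcdr _ _).
have m1 : f1 \is monic by rewrite -(monicMr _ mP) -Df.
have cP1 : coprimep P f1.
  by have := sepf; rewrite Df separable_mul coprimep_sym => /and3P[].
have [[c1 c2] /= Dc] := Bezout_eq1_coprimepP _ _ cP1.
have [v Dv] := rchar_irreducible_exists oddF mP iP.
have Dc1 : c1 * P = 1 - c2 * f1 by rewrite -Dc addrK.
have Dc2 : c2 * f1 = 1 - c1 * P by rewrite -Dc addrC addKr.
pose u := v * (c2 * f1) + c1 * P.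
have DuP : u = (1 - v) * c1 * P + v by rewrite /u Dc2; ring.
have Du1 : u = (v - 1) * c2 * f1 + 1 by rewrite /u Dc1; ring.
exists u; last first.
  have -> : u * b = b + (v - 1) * (c2 * b1) * f by rewrite Du1 Db Df; ring.
  by rewrite modpD modp_mull addr0.
rewrite {1}Df /rchar pnorm_mul -?Df // qcharM // -(pnorm_mod f1) -(pnorm_mod P).
rewrite Du1 modpD modp_mull add0r pnorm_mod pnormC ?monic_neq0 // expr1n qchar1.
by rewrite -Du1 DuP modpD modp_mull add0r pnorm_mod mul1r.
Qed.

Lemma rchar_noncoprime b : ~~ coprimep f b -> rchar f b = 0.
Proof.
move=> /rchar_primitive[u Du ub]; have : rchar f b = - rchar f b.
  by rewrite -{1}(rchar_mod f b) -ub rchar_mod rcharM // Du mulN1r.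
lia.
Qed.

Lemma inv_mod u : coprimep f u -> exists c, (c * u) %% f = 1 %% f.
Proof.
case/Bezout_eq1_coprimepP => -[c1 c2] /= Dc; exists c2.
by rewrite -Dc modpD modp_mull add0r.
Qed.

Lemma rchar_coprime_sqr b : coprimep f b -> rchar f b * rchar f b = 1.
Proof.
move=> /inv_mod[c Dc]; have : rchar f c * rchar f b = 1.
  by rewrite -rcharM // -rchar_mod Dc rchar_mod rchar1.
by rewrite /rchar; case/or3P: (qchar_val (pnorm f b)) => /eqP->; rewrite // mulr0.
Qed.

(** * Fourier analysis on polynomials of bounded degree and the functional equation *)

Definition polys n : seq {poly F} := [seq polyn v | v <- enum [set: {poly_n F}]].

Lemma mem_polys n h : (h \in polys n) = (size h <= n)%N.
Proof.
apply/mapP/idP => [[v _ ->]|hn]; first exact: size_npoly.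
by exists (NPoly hn); rewrite ?mem_enum ?inE.
Qed.

Lemma polys_uniq n : uniq (polys n).
Proof. by rewrite map_inj_uniq ?enum_uniq //; apply: val_inj. Qed.

Lemma size_polys n : size (polys n) = (q ^ n)%N.
Proof. by rewrite size_map -cardE cardsT card_npoly. Qed.

Lemma sum_polys_const (R : nmodType) n (x : R) :
  \sum_(h <- polys n) x = x *+ q ^ n.
Proof. by rewrite big_const_seq count_predT size_polys iter_addr_0. Qed.

Lemma monicsE n : monics F n = [seq 'X^n + h | h <- polys n].
Proof. by rewrite /monics /polys -map_comp. Qed.

Lemma big_perm_map (T : eqType) (R : nmodType) (s : seq T) (h k : T -> T) (G : T -> R) :
    uniq s -> {in s, forall x, h x \in s} -> {in s, forall x, k x \in s} ->
    {in s, cancel h k} -> {in s, cancel k h} ->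
  \sum_(x <- s) G (h x) = \sum_(x <- s) G x.
Proof.
move=> us hs ks hk kh; rewrite -(big_map h predT G); apply: perm_big.
apply: uniq_perm => // [|x]; first by rewrite map_inj_in_uniq //; apply: can_in_inj hk.
apply/mapP/idP => [[y ys ->]|xs]; first exact: hs.
by exists (k x); [apply: ks | rewrite kh].
Qed.

Lemma sum_polys_addr (R : nmodType) n (b : {poly F}) (G : {poly F} -> R) : (size b <= n)%N ->
  \sum_(h <- polys n) G (h + b) = \sum_(h <- polys n) G h.
Proof.
move=> bn; apply: (@big_perm_map _ _ _ (fun h => h + b) (fun h => h - b)); rewrite ?polys_uniq // => h.
- by rewrite !mem_polys => hn; rewrite (leq_trans (size_polyD _ _)) // geq_max hn.
- rewrite !mem_polys => hn; rewrite (leq_trans (size_polyD _ _)) // geq_max hn.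
  by rewrite size_polyN.
- by rewrite addrK.
- by rewrite subrK.
Qed.

Lemma sum_polys_scale (R : nmodType) n c (G : {poly F} -> R) : c != 0 ->
  \sum_(h <- polys n) G (c *: h) = \sum_(h <- polys n) G h.
Proof.
move=> c0; apply: (@big_perm_map _ _ _ (fun h => c *: h) (fun h => c^-1 *: h)); rewrite ?polys_uniq // => h.
- by rewrite !mem_polys size_scale.
- by rewrite !mem_polys size_scale ?invr_eq0.
- by rewrite scalerA mulVf ?scale1r.
- by rewrite scalerA mulfV ?scale1r.
Qed.

Lemma sum_polys_mulmod (R : nmodType) u (G : {poly F} -> R) : coprimep f u ->
  \sum_(h <- polys d) G ((u * h) %% f) = \sum_(h <- polys d) G h.
Proof.
move=> /inv_mod[c Dc]; have mod_d h : h %% f \in polys d.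
  by rewrite mem_polys -ltnS -sf ltn_modp.
have K a b h : (a * b) %% f = 1 %% f -> h \in polys d ->
    (a * ((b * h) %% f)) %% f = h.
  rewrite mem_polys => ab hd; rewrite modp_mul mulrA mulrC -modp_mul ab modp_mul mulr1.
  by rewrite modp_small // sf ltnS.
apply: (@big_perm_map _ _ _ (fun h => (u * h) %% f) (fun h => (c * h) %% f)); rewrite ?polys_uniq // => h.
  exact: K.
by apply: K; rewrite mulrC.
Qed.

Lemma sum_polys_size (R : nmodType) n m (G : {poly F} -> R) : (n <= m)%N ->
  \sum_(h <- polys m | (size h <= n)%N) G h = \sum_(h <- polys n) G h.
Proof.
move=> nm; rewrite -big_filter; apply: perm_big; apply: uniq_perm => [||h].
- exact/filter_uniq/polys_uniq.
- exact: polys_uniq.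
rewrite [LHS](mem_filter (fun h : {poly F} => size h <= n)%N) !mem_polys.
by apply/andP/idP => [[]//|hn]; rewrite hn (leq_trans hn).
Qed.

Lemma sum_polysS (R : nmodType) n (G : {poly F} -> R) :
  \sum_(h <- polys n.+1) G h = \sum_(c : F) \sum_(h <- polys n) G (c *: 'X^n + h).
Proof.
pose s := [seq c *: 'X^n + h | c <- enum F, h <- polys n].
transitivity (\sum_(h <- s) G h); last by rewrite big_allpairs_dep big_enum.
apply: perm_big; apply: uniq_perm => [||h].
- exact: polys_uniq.
- apply: allpairs_uniq; rewrite ?enum_uniq ?polys_uniq // => -[c1 h1] [c2 h2].
  move=> /allpairsPdep[? [? [_ + [-> ->]]]] /allpairsPdep[? [? [_ + [-> ->]]]] /=.
  rewrite !mem_polys => s1 s2 /[dup] /(congr1 (coefp n)) /=.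
  rewrite !coefD !coefZ !coefXn eqxx !mulr1 !nth_default // !addr0 => <-.
  by move/addrI->.
rewrite mem_polys; apply/idP/allpairsP => [hn|[[c k] /= [_ + ->]]].
  exists (h`_n, h - h`_n *: 'X^n); rewrite mem_enum /=; split=> //; last by rewrite addrC subrK.
  rewrite mem_polys; apply/leq_sizeP => j; rewrite leq_eqVlt => /predU1P[<-|nj].
    by rewrite coefB coefZ coefXn eqxx mulr1 subrr.
  rewrite coefB coefZ coefXn gtn_eqF // mulr0 subr0 nth_default //.
  exact: leq_trans nj.
rewrite mem_polys => kn; rewrite (leq_trans (size_polyD _ _)) // geq_max.
by rewrite (leq_trans (size_scale_leq _ _)) ?size_polyXn //= ltnW.
Qed.

Lemma sum_polys_lead (R : nmodType) n c (G : {poly F} -> R) : c != 0 ->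
  \sum_(h <- polys n) G (c *: 'X^n + h) = \sum_(h <- monics F n) G (c *: h).
Proof.
move=> c0; rewrite -(sum_polys_scale n (fun h => G (_ + h)) c0) monicsE [RHS]big_map.
by apply: eq_bigr => h _; rewrite scalerDr.
Qed.

Lemma sum_rchar : \sum_(h <- polys d) rchar f h = 0.
Proof.
have nf0 : ~~ coprimep f 0 by rewrite coprimep0 -size_poly_eq1 sf eqSS -lt0n.
have [u Du _] := rchar_primitive nf0.
have cu : coprimep f u by apply: contraTT isT => /rchar_noncoprime; rewrite Du.
have : \sum_(h <- polys d) rchar f h = - \sum_(h <- polys d) rchar f h.
  rewrite -{1}(sum_polys_mulmod _ cu) -sumrN; apply: eq_bigr => h _.
  by rewrite rchar_mod rcharM // Du mulN1r.
lia.
Qed.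

Definition Rcoef n := \sum_(h <- monics F n) rchar f h.

(** Translation by any b of degree less than d permutes the monic polynomials of degree n >= d.
    Averaging over b gives sums over complete residue systems modulo f, which vanish. *)
Lemma Rcoef_large n : (d <= n)%N -> Rcoef n = 0.
Proof.
move=> dn; suff : Rcoef n *+ q ^ d = 0.
  by move/eqP; rewrite mulrn_eq0 expn_eq0 /q (cardD1 0) => /eqP.
rewrite -sum_polys_const /Rcoef monicsE.
transitivity (\sum_(b <- polys d) \sum_(h <- polys n) rchar f (('X^n + h) + b)).
  rewrite big_seq [RHS]big_seq; apply: eq_bigr => b; rewrite mem_polys => bd.
  rewrite big_map -(sum_polys_addr _ (leq_trans bd dn)).
  by apply: eq_bigr => h _; rewrite addrA.
rewrite exchange_big big1 //= => h _; rewrite -[RHS]sum_rchar.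
move: ('X^n + h) => v; have vd : (size (v %% f)%R <= d)%N by rewrite -ltnS -sf ltn_modp.
rewrite -[RHS](sum_polys_addr _ vd); apply: eq_bigr => b _.
by rewrite -rchar_mod -[RHS]rchar_mod !modpD modp_id addrC.
Qed.

Lemma Rcoef_polysS n : \sum_(h <- polys n.+1) rchar f h =
  \sum_(h <- polys n) rchar f h + (\sum_(c : F | c != 0) qchar c ^+ d) * Rcoef n.
Proof.
rewrite sum_polysS (bigD1 0) //= mulr_suml; congr (_ + _).
  by apply: eq_bigr => h _; rewrite scale0r add0r.
apply: eq_bigr => c c0; rewrite sum_polys_lead // mulr_sumr; apply: eq_bigr => h _.
by rewrite -mul_polyC rcharM // rcharC // sf.
Qed.

(* [pairing] is a perfect symmetric pairing on F[x] / (f) for which the annihilator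
   of the polynomials of size at most m is the space of those of size at most
   d - m, so [hat] is a Fourier transform and [hat w 1] a Gauss sum. *)
Definition pairing a b := ((a * b) %% f)`_d.-1.

Definition hat (w : F -> int) b := \sum_(a <- polys d) rchar f a * w (pairing a b).

Lemma hatM w u b : coprimep f u -> hat w (u * b) = rchar f u * hat w b.
Proof.
move=> cu; rewrite /hat -[in RHS](sum_polys_mulmod _ cu) mulr_sumr.
apply: eq_bigr => a _; rewrite rchar_mod rcharM // mulrA mulrA rchar_coprime_sqr // mul1r.
congr (_ * w _); rewrite /pairing [(u * a) %% f * b]mulrC modp_mul.
by congr (_ %% _)`__; ring.
Qed.

(** For b coprime to f this is a substitution in the sum. Otherwise primitivity of the symbol is
    used: some u fixes b modulo f but has symbol -1, so both sides vanish. *)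
Lemma hatE w b : hat w b = rchar f b * hat w 1.
Proof.
have [cb|nb] := boolP (coprimep f b); first by rewrite -hatM ?mulr1.
rewrite rchar_noncoprime // mul0r.
have [u Du ub] := rchar_primitive nb.
have cu : coprimep f u by apply: contraTT isT => /rchar_noncoprime; rewrite Du.
have : hat w b = - hat w b.
  rewrite -mulN1r -Du -hatM // /hat; apply: eq_bigr => a _.
  by rewrite /pairing -(modp_mul a b) -ub modp_mul.
lia.
Qed.

Lemma pairingD a b c : pairing a (b + c) = pairing a b + pairing a c.
Proof. by rewrite /pairing mulrDr modpD coefD. Qed.

Lemma pairingZ a b c : pairing a (c *: b) = c * pairing a b.
Proof. by rewrite /pairing -scalerAr modpZl coefZ. Qed.

(** Pairing with [a] is a nonzero linear form on polynomials of size at most m, hence takes all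
    values equally often. The vector [b1] of value 1 lifts the leading term of [a] to degree d -
    1. *)
Lemma sum_pairing_large w a b m : (d - m < size a <= d)%N -> (m <= d)%N ->
  (\sum_(v <- polys m) w (pairing a (b + v))) *+ q = (\sum_x w x) *+ (q ^ m).
Proof.
case/andP=> am ad md; have a0 : a != 0 by rewrite -size_poly_gt0; apply: leq_trans am.
have lc0 : lead_coef a != 0 by rewrite lead_coef_eq0.
pose b1 := (lead_coef a)^-1 *: 'X^(d - size a); have pb1 : pairing a b1 = 1.
  rewrite pairingZ /pairing modp_small; last first.
    by rewrite size_mulXn // subnK // sf ltnS.
  rewrite coefMXn ifF; last by apply/negbTE; rewrite -leqNgt; lia.
  have -> : (d.-1 - (d - size a) = (size a).-1)%N by lia.
  by rewrite -lead_coefE mulVf.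
have sb1 : (size b1 <= m)%N.
  by rewrite size_scale ?invr_eq0 // size_polyXn; move: am ad md; lia.
rewrite -sumr_const -sum_polys_const.
transitivity (\sum_(x : F) \sum_(v <- polys m) w (pairing a (b + v) + x)).
  apply: eq_bigr => x _; rewrite -(sum_polys_addr _ (leq_trans (size_scale_leq x _) sb1)).
  by apply: eq_bigr => v _; rewrite addrA (pairingD a (b + v)) pairingZ pb1 mulr1.
rewrite exchange_big; apply: eq_bigr => v _.
by rewrite [RHS](reindex_inj (addrI (pairing a (b + v)))).
Qed.

Lemma pairing_small a (v : {poly F}) m : (size a <= d - m)%N -> (size v <= m)%N -> (m <= d)%N ->
  pairing a v = 0.
Proof.
move=> am vm md; have svd : (size (a * v)%R <= d.-1)%N.
  by rewrite (leq_trans (size_polyMleq _ _)) //; move: am vm md; lia.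
rewrite /pairing modp_small; first by rewrite nth_default.
by rewrite sf (leq_ltn_trans svd) // ltnS leq_pred.
Qed.

Lemma pairing_Xn a m : (size a <= d - m)%N -> (m < d)%N -> pairing a 'X^m = a`_(d.-1 - m).
Proof.
move=> am md; rewrite /pairing modp_small; last first.
  rewrite sf ltnS (leq_trans (size_polyMleq _ _)) // size_polyXn.
  by rewrite addnS /= addnC -leq_subRL // ltnW.
by rewrite coefMXn ifF //; apply/negbTE; rewrite -leqNgt; lia.
Qed.

(** The transform for w = [qchar] is summed over the polynomials X^k + v in two ways. By [hatE] the
    result is the Gauss sum times [Rcoef k]. After exchanging the sums only a of size at most d - k
    remain, because [qchar] sums to zero; for odd d the symbol restricts to [qchar] on constants, so
    leading coefficients contribute q - 1. The case k = 0 evaluates the Gauss sum. *)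
Lemma functional_odd m : odd d -> (m < d)%N ->
  Rcoef d.-1 * Rcoef m = (q ^ m)%:Z * Rcoef (d.-1 - m).
Proof.
move=> oddd md; have qn1 : (q.-1%:Z) != 0.
  by have := finNzRing_gt1 F; rewrite -/q; case: q => [|[]].
have sum1 : \sum_(c : F | c != 0) (1 : int) = q.-1%:Z.
  by rewrite sumr_const cardC1 natz.
have key k : (k < d)%N -> hat (@qchar F) 1 * Rcoef k =
    (q ^ k)%:Z * (q.-1%:Z * Rcoef (d.-1 - k)).
  move=> kd; transitivity (\sum_(v <- polys k) hat (@qchar F) ('X^k + v)).
    rewrite /Rcoef monicsE big_map mulr_sumr; apply: eq_bigr => v _.
    by rewrite [RHS]hatE mulrC.
  rewrite exchange_big /=.
  transitivity (\sum_(a <- polys d | (size a <= (d.-1 - k).+1)%N)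
      (q ^ k)%:Z * (rchar f a * qchar a`_(d.-1 - k))).
    rewrite [RHS]big_mkcond big_seq [RHS]big_seq; apply: eq_bigr => a.
    rewrite mem_polys => ad; rewrite -mulr_sumr -subSn ?prednK //; last by lia.
    case: leqP => ak; last first.
      have := sum_pairing_large (@qchar F) (a := a) 'X^k (m := k).
      rewrite ak ad ltnW // => /(_ isT isT)/eqP.
      rewrite sum_qchar // mul0rn mulrn_eq0 /q (cardD1 0) => /eqP->.
      by rewrite mulr0.
    rewrite (eq_big_seq (fun=> qchar a`_(d.-1 - k))) => [|v]; last first.
      rewrite mem_polys => vk; rewrite pairingD pairing_Xn //.
      by rewrite (pairing_small ak vk) ?addr0 // ltnW.
    by rewrite sum_polys_const -mulr_natl natz; ring.
  rewrite sum_polys_size; last by lia.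
  rewrite -mulr_sumr sum_polysS (bigD1 0) //= big_seq big1 ?add0r; last first.
    move=> h; rewrite mem_polys => hk; rewrite coefD coefZ mul0r add0r.
    by rewrite nth_default // qchar0 mulr0.
  rewrite -sum1 mulr_suml; congr (_ * _); apply: eq_bigr => c c0.
  rewrite (sum_polys_lead _ (fun h => rchar f h * qchar h`_(d.-1 - k))) // mul1r.
  rewrite big_seq /Rcoef [RHS]big_seq; apply: eq_bigr => h; rewrite mem_monics.
  case/andP=> mh /eqP sh; rewrite coefZ -[(d.-1 - k)%N]/((d.-1 - k).+1.-1) -sh -lead_coefE.
  rewrite (monicP mh) mulr1 -mul_polyC rcharM // rcharC // sf /= mulrAC -exprSr.
  rewrite -[d.+1]odd_double_half /= oddd add0n -mul2n exprM expr2 qchar_sqr //.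
  by rewrite expr1n mul1r.
have G1 : hat (@qchar F) 1 = q.-1%:Z * Rcoef d.-1.
  have := key 0%N d0; rewrite expn0 mul1r subn0 => <-.
  by rewrite /Rcoef monics0 big_seq1 rchar1 // mulr1.
by have := key m md; rewrite G1 -mulrA [RHS]mulrCA => /(mulfI qn1).
Qed.

(** [Rsum n.+1] is the coefficient of T^n in L(T) / (1 - T). For even d the symbol is trivial on
    nonzero constants and L has the trivial zero T = 1, which is [Rsum_d]. *)
Definition Rsum n := \sum_(k < n) Rcoef k.

Lemma sum_rchar_even n : ~~ odd d ->
  \sum_(h <- polys n) rchar f h = q.-1%:Z * Rsum n.
Proof.
move=> evend; have sum1 : \sum_(c : F | c != 0) qchar c ^+ d = q.-1%:Z.
  rewrite (eq_bigr (fun=> 1)) => [|c c0]; first by rewrite sumr_const cardC1 natz.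
  rewrite -[d]odd_double_half (negPf evend) add0n -mul2n exprM expr2 qchar_sqr //.
  by rewrite expr1n.
elim: n => [|n IH]; last by rewrite Rcoef_polysS IH sum1 -mulrDr /Rsum big_ord_recr.
rewrite /Rsum big_ord0 mulr0 big_seq big1 // => h.
rewrite mem_polys leqn0 size_poly_eq0 => /eqP->.
by rewrite rchar_noncoprime // coprimep0 -size_poly_eq1 sf eqSS -lt0n.
Qed.

Lemma Rsum_d : ~~ odd d -> Rsum d = 0.
Proof.
move=> /(sum_rchar_even d)/esym/eqP; rewrite sum_rchar mulf_eq0.
by have := finNzRing_gt1 F; rewrite -/q; case: q => [|[|n]] //= _ /eqP.
Qed.

(** The same double count with w the indicator of 0. Its sum is 1, so every a now contributes a
    common multiple of its symbol, but these contributions cancel because the symbol sums to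
    zero. *)
Lemma functional_even m : ~~ odd d -> (m <= d)%N ->
  q%:Z * (Rsum d.-1 * Rsum m) = (q ^ m)%:Z * Rsum (d - m).
Proof.
move=> evend md; have qn1 : (q.-1%:Z) != 0.
  by have := finNzRing_gt1 F; rewrite -/q; case: q => [|[]].
pose w (x : F) : int := (x == 0)%:R.
have sumw : \sum_x w x = 1.
  by rewrite (bigD1 0) //= /w eqxx big1 ?addr0 // => x /negPf->.
have key k : (k <= d)%N -> q%:Z * (hat w 1 * Rsum k) =
    (q ^ k)%:Z * (q.-1%:Z * Rsum (d - k)).
  move=> kd; apply: (mulfI qn1).
  transitivity (q%:Z * \sum_(v <- polys k) hat w v).
    rewrite mulrCA [_ * (hat w 1 * _)]mulrCA -sum_rchar_even // mulr_sumr.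
    by congr (_ * _); apply: eq_bigr => v _; rewrite [RHS]hatE mulrC.
  rewrite exchange_big mulr_sumr /=.
  transitivity (\sum_(a <- polys d) ((q ^ k)%:Z * rchar f a +
       if (size a <= d - k)%N then (q ^ k)%:Z * q.-1%:Z * rchar f a else 0)).
    rewrite big_seq [RHS]big_seq; apply: eq_bigr => a.
    rewrite mem_polys => ad; rewrite -mulr_sumr mulrCA.
    case: leqP => ak; last first.
      have := sum_pairing_large w (a := a) 0 (m := k).
      rewrite ak ad kd => /(_ isT isT); rewrite sumw -mulr_natl !natz.
      under eq_bigr => v _ do rewrite add0r.
      by move=> ->; rewrite addr0 mulrC.
    rewrite (eq_big_seq (fun=> 1)) => [|v]; last first.
      by rewrite mem_polys => vk; rewrite (pairing_small ak vk) // /w eqxx.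
    rewrite sum_polys_const natz; have : q%:Z = 1 + q.-1%:Z.
      by rewrite -intS prednK // /q (cardD1 0).
    by move=> ->; ring.
  rewrite big_split /= -mulr_sumr sum_rchar mulr0 add0r -big_mkcond sum_polys_size ?leq_subr //.
  by rewrite -mulr_sumr sum_rchar_even //; ring.
have q0 : q%:Z != 0 by rewrite /q (cardD1 0).
have G1 : hat w 1 = q.-1%:Z * Rsum d.-1.
  have := key 1%N d0; rewrite expn1 subn1 => /(mulfI q0) <-.
  by rewrite /Rsum big_ord1 /Rcoef monics0 big_seq1 rchar1 // mulr1.
by have := key m md; rewrite G1 -mulrA mulrCA [RHS]mulrCA => /(mulfI qn1).
Qed.

End ResidueCharacter.

(** * The numerator of the zeta function *)

(** The field is a splitting field of X^(q^r) - X. Existence matters: otherwise the condition of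
    [is_Lpoly] in degree r could be vacuous and would not determine L. *)
Lemma finField_extension_exists (F : finFieldType) (r : nat) : (0 < r)%N ->
  exists (E : finFieldType) (phi : {rmorphism F -> E}), #|E| = (#|F| ^ r)%N.
Proof.
move=> r0; set q := #|F|; set m := (q ^ r)%N.
have q1 : (1 < q)%N := finNzRing_gt1 F.
have m1 : (1 < m)%N by rewrite -(expn0 q) ltn_exp2l.
pose X (R : nzRingType) : {poly R} := 'X^m - 'X.
have sX (R : nzRingType) : size (X R) = m.+1.
  by rewrite size_polyDl ?size_polyXn // size_polyN size_polyX.
have X0 : X F != 0 by rewrite -size_poly_eq0 sX.
have [L [zs DX defL]] := FinSplittingFieldFor X0.
have XL : map_poly (in_alg L) (X F) = X L.
  by rewrite rmorphB /= map_polyXn map_polyX.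
rewrite XL in DX; pose E : finFieldType := FinFieldExtType L.
exists E, (in_alg L).
have mL : m%:R = 0 :> L.
  rewrite /m natrX -(rmorph_nat (in_alg L)) finField_natr_card rmorph0.
  by rewrite expr0n gtn_eqF.
have uz : uniq zs.
  rewrite -separable_prod_XsubC -(eqp_separable DX) unlock derivB derivXn derivX.
  rewrite -mulr_natl -polyC_natr mL mul0r sub0r -scaleN1r.
  by rewrite coprimepZr ?oppr_eq0 ?oner_eq0 // coprimep1.
have [/= a _ Da] := finField_galois_generator (sub1v {:L}).
rewrite dimv1 expn1 in Da.
(* The roots form the fixed field of the r-th power of Frobenius; as they also generate [L], they
   are all of [L]. *)
pose Em := fixedSpace (a ^+ r)%g; have in_zs : zs =i Em.
  move=> z; rewrite -root_prod_XsubC -(eqp_root DX) (sameP fixedSpaceP eqP).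
  rewrite /root !hornerE subr_eq0 /m; congr (_ == z).
  elim: (r) => [|i IHi]; first by rewrite gal_id.
  by rewrite expgSr expnSr exprM IHi galM ?Da ?memvf.
suffices /eq_card-> : E =i zs.
  apply: succn_inj; rewrite (card_uniqP _) //= -(size_prod_XsubC _ id).
  by rewrite -(eqp_size DX) sX.
suffices defE : Em = {:L}%VS by move=> z; rewrite in_zs defE memvf.
apply/eqP; rewrite eqEsubv subvf -defL -[Em]subfield_closed agenvS //.
by rewrite subv_add sub1v; apply/span_subvP=> z; rewrite in_zs.
Qed.

Section Numerator.

Variables (F : finFieldType) (g d : nat) (f : {poly F}).
Hypothesis oddF : odd #|F|.
Hypothesis mf : f \is monic.
Hypothesis sf : size f = d.+1.
Hypothesis sepf : separable_poly f.
Hypothesis hd : d = (2 * g + 1)%N \/ d = (2 * g + 2)%N.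
Let q := #|F|.

Let d0 : (0 < d)%N.
Proof. by case: hd => ->; lia. Qed.

(** For even d the L-function is divided by its trivial factor 1 - T, which turns coefficients into
    partial sums. *)
Definition numerator_coef n : int :=
  if odd d then Lcoef (lchar f) n else \sum_(k < n.+1) Lcoef (lchar f) k.

(** With this sign it is minus the r-th power sum of the eigenvalues. For even d the division by 1 -
    T adds 1, which accounts for the second point at infinity. *)
Definition frobenius_trace r : int :=
  (if odd d then 0 else 1) + Lpower (lchar f) r r.

Lemma Lcoef_Rcoef n : Lcoef (lchar f) n = qchar (-1 : F) ^+ (d * n) * Rcoef f n.
Proof.
rewrite /Lcoef /Rcoef mulr_sumr big_seq [RHS]big_seq; apply: eq_bigr => h.
by rewrite mem_monics => /andP[_ /eqP sh]; rewrite lcharE // sf sh.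
Qed.

Lemma Lcoef_Rcoef_even n : ~~ odd d -> Lcoef (lchar f) n = Rcoef f n.
Proof.
move=> evend; rewrite Lcoef_Rcoef -[d]odd_double_half (negPf evend) add0n -mul2n.
by rewrite -mulnA exprM expr2 qchar_sqr ?oppr_eq0 ?oner_eq0 // expr1n mul1r.
Qed.

Lemma numerator_coef_even n : ~~ odd d -> numerator_coef n = Rsum f n.+1.
Proof.
move=> evend; rewrite /numerator_coef (negPf evend); apply: eq_bigr => k _.
exact: Lcoef_Rcoef_even.
Qed.

Lemma numerator_coef0 : numerator_coef 0 = 1.
Proof. by rewrite /numerator_coef big_ord1 Lcoef0 ?lchar1 // if_same. Qed.

Lemma numerator_coef_large n : (2 * g < n)%N -> numerator_coef n = 0.
Proof.
move=> gn; have dn : (d <= n.+1)%N by case: hd; lia.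
case: (boolP (odd d)) => oddd.
  rewrite /numerator_coef oddd Lcoef_Rcoef (Rcoef_large oddF mf sf d0 sepf) ?mulr0 //.
  by case: hd oddd => ->; rewrite ?oddD ?oddM /=; lia.
rewrite numerator_coef_even // -(subnK dn) /Rsum addnC big_split_ord /=.
rewrite [X in X + _](Rsum_d oddF mf sf d0 sepf) // add0r big1 // => i _.
by rewrite (Rcoef_large oddF mf sf d0 sepf) // leq_addr.
Qed.

Lemma numerator_functional i : (i <= 2 * g)%N ->
  numerator_coef (2 * g) * numerator_coef i
    = (q ^ i)%:Z * numerator_coef (2 * g - i).
Proof.
move=> ig; case: (boolP (odd d)) => oddd.
  have Dd : d = (2 * g).+1 by move: oddd; case: hd; lia.
  rewrite /numerator_coef oddd !Lcoef_Rcoef -[(2 * g)%N]/((2 * g).+1.-1) -Dd.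
  have := functional_odd oddF mf sf d0 sepf (m := i) oddd; rewrite Dd ltnS => /(_ ig).
  (* The sign between the two symbols depends only on the parity of the index, which i and 2g - i
     share. *)
  rewrite [_.+1.-1]/= -/q => E; have sgn n : qchar (-1 : F) ^+ ((2 * g).+1 * n) = qchar (-1 : F) ^+ odd n.
    case/or3P: (qchar_val (-1 : F)) => [|/eqP->|/eqP->]; rewrite ?expr1n //.
      by rewrite qchar_eq0 oppr_eq0 oner_eq0.
    by rewrite -signr_odd oddM /= oddM.
  rewrite !sgn oddB // oddM /= mul1r.
  by rewrite mulrCA [RHS]mulrCA E.
have Dd : (d = (2 * g).+2)%N by move: oddd; case: hd; lia.
rewrite !numerator_coef_even //; have q0 : q%:Z != 0 by rewrite /q (cardD1 0).
apply: (mulfI q0).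
have := functional_even oddF mf sf d0 sepf (m := i.+1) oddd; rewrite Dd => /(_ (leqW ig)).
by rewrite subSS subSn // -/q expnS PoszM -mulrA.
Qed.

Lemma numerator_rec n : numerator_coef n *+ n =
  \sum_(1 <= r < n.+1) frobenius_trace r * numerator_coef (n - r).
Proof.
have Crec m : Lcoef (lchar f) m *+ m =
    \sum_(1 <= r < m.+1) Lpower (lchar f) r r * Lcoef (lchar f) (m - r).
  rewrite (Lcoef_rec (lchar1 mf oddF) (fun P h => @lcharM F f mf oddF P h)).
  by apply: eq_big_nat => r rm; rewrite Lpower_le.
rewrite /frobenius_trace /numerator_coef; case: (boolP (odd d)) => oddd.
  by rewrite Crec; apply: eq_bigr => r _; rewrite add0r.
set c := Lcoef _ in Crec *.
elim: n => [|n IH]; first by rewrite mulr0n big_geq.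
rewrite big_ord_recr /= mulrnDl Crec mulrSr IH [RHS]big_nat_recr //= subnn big_ord1.
rewrite [\sum_(1 <= r < n.+2) _]big_nat_recr //= subnn.
have -> : \sum_(1 <= r < n.+1) (1 + Lpower (lchar f) r r) * \sum_(k < (n.+1 - r).+1) c k =
   \sum_(1 <= r < n.+1) (1 + Lpower (lchar f) r r) * \sum_(k < (n - r).+1) c k
   + \sum_(1 <= r < n.+1) Lpower (lchar f) r r * c (n.+1 - r)%N
   + \sum_(1 <= r < n.+1) c (n.+1 - r)%N.
  rewrite -!big_split /=; apply: eq_big_nat => r /andP[r1 rn].
  by rewrite subSn // [\sum_(k < (n - r).+2) _]big_ord_recr /=; ring.
have -> : \sum_(k < n.+1) c k = \sum_(1 <= r < n.+1) c (n.+1 - r)%N + c 0%N.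
  rewrite big_ord_recl addrC; congr (_ + _).
  rewrite big_nat_rev /= big_add1 big_mkord; apply: eq_bigr => k _; congr (c _).
  by rewrite /bump /=; have := ltn_ord k; lia.
by ring.
Qed.

Lemma npoints_frobenius_trace r (E : finFieldType) (phi : {rmorphism F -> E}) :
    (0 < r)%N -> #|E| = (q ^ r)%N ->
  (npoints g (map_poly phi f))%:Z = (q ^ r)%:Z + 1 + frobenius_trace r.
Proof.
move=> r0 cE; have oddE : odd #|E| by rewrite cE oddX oddF orbT.
rewrite /npoints PoszD card_sqr // coef_map /=.
have -> : #|[set P : E * E | P.2 ^+ 2 == (map_poly phi f).[P.1]]|%:Z =
    (q ^ r)%:Z + Lpower (lchar f) r r.
  rewrite -(sum_qchar_horner mf oddF phi r0 cE) -cE.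
  rewrite -sum1_card (partition_big fst predT) //=.
  rewrite (big_morph Posz PoszD (erefl _)).
  rewrite (eq_bigr (fun x => 1 + qchar (map_poly phi f).[x])) => [|x _].
    by rewrite big_split /= sumr_const natz.
  rewrite -card_sqr // -sum1_card; congr (Posz _).
  rewrite (reindex_onto (fun v => (x, v)) snd) => [|[a b] /andP[_ /eqP/=->]] //.
  by apply: eq_bigl => v; rewrite !inE /= !eqxx !andbT.
rewrite /frobenius_trace; case: hd => Dd.
  have -> : f`_(2 * g + 2) = 0 by rewrite nth_default // sf Dd !addnS.
  by rewrite rmorph0 qchar0 ifT; [ring | lia].
have -> : f`_(2 * g + 2) = 1 by have := monicP mf; rewrite lead_coefE sf Dd.
by rewrite rmorph1 qchar1 ifF; [ring | lia].
Qed.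

End Numerator.

(** * Power sums and logarithmic derivatives *)

Lemma newton_identity (R : comNzRingType) (s : seq R) n :
  let Q := \prod_(a <- s) (1 - a *: 'X) in
  Q`_n *+ n = - \sum_(1 <= r < n.+1) (\sum_(a <- s) a ^+ r) * Q`_(n - r).
Proof.
elim: s n => [|a s IH] /= n.
  rewrite big_nil big1 => [|r _]; last by rewrite big_nil mul0r.
  by rewrite oppr0 coef1; case: n => [|n] //=; rewrite mul0rn.
case: n => [|m]; first by rewrite mulr0n big_geq ?oppr0.
rewrite big_cons; set Q := \prod_(b <- s) _ in IH *.
set Q' := _ * Q; pose p r := \sum_(b <- s) b ^+ r.
have Q'0 : Q'`_0 = Q`_0.
  by rewrite /Q' mulrBl mul1r -scalerAl coefB coefZ coefXM mulr0 subr0.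
have Q'S k : Q'`_k.+1 = Q`_k.+1 - a * Q`_k.
  by rewrite /Q' mulrBl mul1r -scalerAl coefB coefZ coefXM.
(* Effect of the new factor 1 - a X on a convolution with the coefficients. *)
have step G : \sum_(1 <= r < m.+2) G r * Q'`_(m.+1 - r) =
    \sum_(1 <= r < m.+2) G r * Q`_(m.+1 - r) - a * \sum_(1 <= r < m.+1) G r * Q`_(m - r).
  rewrite !(@big_nat_recr _ _ _ m.+1) //= subnn Q'0 addrAC mulr_sumr -sumrB.
  congr (_ + _); apply: eq_big_nat => r /andP[r1 rm].
  by rewrite subSn // Q'S; ring.
have Ep : \sum_(1 <= r < m.+2) p r * Q'`_(m.+1 - r) =
    - (Q`_m.+1 *+ m.+1) + a * (Q`_m *+ m) by rewrite step !IH; ring.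
have Ea : \sum_(1 <= r < m.+2) a ^+ r * Q'`_(m.+1 - r) = a * Q`_m.
  rewrite step mulr_sumr [X in X - _]big_ltn // expr1 subSS subn0.
  rewrite [X in _ + X - _]big_add1 /= -addrA -[RHS]addr0; congr (_ + _).
  rewrite -sumrB big1_seq // => r _; rewrite subSS exprS; ring.
rewrite (eq_bigr (fun r => p r * Q'`_(m.+1 - r) + a ^+ r * Q'`_(m.+1 - r))); last first.
  by move=> r _; rewrite big_cons mulrDl addrC.
by rewrite big_split /= Ep Ea Q'S mulrnBl -mulrnAr mulrSr; ring.
Qed.

(* A power series with constant term 1 and its logarithmic derivative determine
   each other in characteristic zero. *)
Lemma log_derivative_determines (R : idomainType) (c c' t t' : nat -> R) :
    c 0%N = 1 -> c' 0%N = 1 ->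
    (forall n, c n *+ n = \sum_(1 <= r < n.+1) t r * c (n - r)%N) ->
    (forall n, c' n *+ n = \sum_(1 <= r < n.+1) t' r * c' (n - r)%N) ->
  (forall n, c n = c' n) -> forall r, (0 < r)%N -> t r = t' r.
Proof.
move=> c0 c'0 rc rc' cc' r; move: {2}r (leqnn r) => N.
elim: N r => [|N IH] r rN r0; first by move: (leq_trans r0 rN).
have := rc r; rewrite cc' rc' !big_nat_recr //= subnn c0 c'0 !mulr1.
rewrite (eq_big_nat _ _ (F2 := fun k => t k * c (r - k)%N)) => [/addrI->//|k /andP[k1 kr]].
by rewrite IH ?cc' // -ltnS (leq_trans kr).
Qed.

(** Only 1, ..., m are divided by, so this also serves in characteristic p with m = g < p. *)
Lemma log_derivative_determined (R : idomainType) (c c' t t' : nat -> R) m :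
    (forall k, (0 < k <= m)%N -> k%:R != 0 :> R) ->
    c 0%N = 1 -> c' 0%N = 1 ->
    (forall n, c n *+ n = \sum_(1 <= r < n.+1) t r * c (n - r)%N) ->
    (forall n, c' n *+ n = \sum_(1 <= r < n.+1) t' r * c' (n - r)%N) ->
  (forall r, (0 < r <= m)%N -> t r = t' r) -> c m = c' m.
Proof.
move=> + c0 c'0 rc rc'; move: {2}m (leqnn m) => N.
elim: N m => [|N IH] m mN m_neq0 tt'; first by move: mN; rewrite leqn0 => /eqP->; rewrite c0.
have [->|m0] := posnP m; first by rewrite c0.
have mm : (0 < m <= m)%N by rewrite m0 leqnn.
apply: (mulfI (m_neq0 m mm)); rewrite !mulr_natl rc rc'.
apply: eq_big_nat => r /andP[r1 rm]; rewrite tt' ?r1 //; congr (_ * _).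
have mr : (m - r <= m)%N by apply: leq_subr.
apply: IH => [|k /andP[k0 kr]|k /andP[k0 kr]]; first by move: r1 mN m0; lia.
  by apply: m_neq0; rewrite k0 (leq_trans kr).
by apply: tt'; rewrite k0 (leq_trans kr).
Qed.

(** * Existence and uniqueness of the L-polynomial *)

Section OrdinaryCriterion.

Variables (F : finFieldType) (g d : nat) (f : {poly F}).
Hypothesis oddF : odd #|F|.
Hypothesis mf : f \is monic.
Hypothesis sf : size f = d.+1.
Hypothesis sepf : separable_poly f.
Hypothesis hd : d = (2 * g + 1)%N \/ d = (2 * g + 2)%N.
Let q := #|F|.
Let c := numerator_coef d f.

(** The functional equation at i = 2g says that the square is q^(2g). The sign stays open, but
    valuations only see absolute values. *)
Lemma numerator_coef_last_abs : `|c (2 * g)%N|%N = (q ^ g)%N.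
Proof.
have := numerator_functional oddF mf sf sepf hd (leqnn (2 * g)).
rewrite subnn numerator_coef0 // mulr1 -/c -/q => /(congr1 absz).
have -> : (q ^ (2 * g) = (q ^ g) ^ 2)%N by rewrite mulnC expnM.
by rewrite abszM absz_nat mulnn => /eqP; rewrite eqn_exp2r // => /eqP.
Qed.

Lemma numerator_coef_abs j : (j <= g)%N ->
  (`|c (g + j)| = q ^ j * `|c (g - j)|)%N.
Proof.
move=> jg; have := numerator_functional oddF mf sf sepf hd (i := (g - j)%N).
rewrite -/c -/q => /(_ _)/(congr1 absz); rewrite !abszM absz_nat.
rewrite numerator_coef_last_abs (_ : 2 * g - (g - j) = g + j)%N; last lia.
move=> /(_ ltac:(lia)) H; apply/eqP.
have q0 : (0 < q)%N by rewrite /q (cardD1 0).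
rewrite -(@eqn_pmul2l (q ^ (g - j))) ?expn_gt0 ?q0 //.
by rewrite -H mulnA -expnD subnK.
Qed.

Definition numerator : {poly int} := \poly_(i < (2 * g).+1) c i.

Lemma coef_numerator n : numerator`_n = c n.
Proof.
rewrite coef_poly; case: ltnP => // gn.
by rewrite /c (numerator_coef_large oddF mf sf sepf hd).
Qed.

Let numerator_rec_algC n : (c n)%:~R *+ n =
  \sum_(1 <= r < n.+1) (frobenius_trace d f r)%:~R * (c (n - r)%N)%:~R :> algC.
Proof.
have := numerator_rec oddF mf sf sepf hd n; rewrite -/c => /(congr1 (fun x : int => x%:~R : algC)).
rewrite raddfMn rmorph_sum => ->; apply: eq_bigr => r _; exact: rmorphM.
Qed.

Let newton_algC (s : seq algC) n : let Q := \prod_(a <- s) (1 - a *: 'X) in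
  Q`_n *+ n = \sum_(1 <= r < n.+1) (- \sum_(a <- s) a ^+ r) * Q`_(n - r).
Proof. by rewrite /= newton_identity -sumrN; apply: eq_bigr => r _; rewrite mulNr. Qed.

(** The eigenvalues are the reciprocals of the roots of the numerator in [algC]. Their negated power
    sums satisfy the same recursion as the Frobenius traces, hence agree with them. *)
Lemma is_Lpoly_numerator : is_Lpoly g f numerator.
Proof.
have q0 : (0 < q)%N by rewrite /q (cardD1 0).
have c2g : c (2 * g)%N != 0.
  by rewrite -absz_eq0 numerator_coef_last_abs -lt0n expn_gt0 q0.
have sN : size numerator = (2 * g).+1 by apply: size_poly_eq.
pose N : {poly algC} := map_poly intr numerator.
have sNC : size N = (2 * g).+1 by rewrite size_map_inj_poly // => x y /intr_inj.
have [zs DN] := closed_field_poly_normal N.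
have N0 : N.[0] = 1 by rewrite horner_coef0 coef_map coef_numerator /c numerator_coef0.
have zs0 z : z \in zs -> z != 0.
  move=> zz; apply: contra_eq_neq N0 => z0; rewrite eq_sym DN hornerZ.
  have /rootP : root (\prod_(z <- zs) ('X - z%:P)) 0 by rewrite root_prod_XsubC -z0.
  by move=> ->; rewrite mulr0 oner_eq0.
have szs : size [seq z^-1 | z <- zs] == (2 * g)%N.
  have lc0 : lead_coef N != 0 by rewrite lead_coef_eq0 -size_poly_eq0 sNC.
  by rewrite size_map -eqSS -(size_prod_XsubC zs id) -(size_scale _ lc0) -DN sNC.
have DN' : N = \prod_(a <- Tuple szs) (1 - a *: 'X).
  have Dz : \prod_(z <- zs) ('X - z%:P) =
      (\prod_(z <- zs) (- z)) *: \prod_(a <- Tuple szs) (1 - a *: 'X).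
    rewrite /= big_map -scaler_prod; apply: eq_big_seq => z /zs0 z0.
    by rewrite scalerBr scalerA mulNr mulfV // scaleN1r opprK addrC scaleNr alg_polyC.
  have [l Dl] : exists l, N = l *: \prod_(z <- zs) ('X - z%:P) by exists (lead_coef N).
  rewrite Dl Dz scalerA -[RHS]scale1r; congr (_ *: _).
  move: N0; rewrite Dl Dz !hornerZ horner_prod [X in _ * (_ * X)]big1 ?mulr1 //.
  by move=> a _; rewrite !hornerE ?mulr0 ?subr0.
exists (Tuple szs); split=> // r E phi r0 cE.
have tr : - \sum_(a <- Tuple szs) a ^+ r = (frobenius_trace d f r)%:~R.
  have cN n : (c n)%:~R = (\prod_(a <- Tuple szs) (1 - a *: 'X))`_n :> algC.
    by rewrite -DN' coef_map coef_numerator.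
  have c0 : (c 0)%:~R = 1 :> algC by rewrite /c numerator_coef0.
  apply: (@log_derivative_determines _ (fun n => (c n)%:~R) (fun n => (c n)%:~R)
    (fun r => - \sum_(a <- Tuple szs) a ^+ r)
    (fun r => (frobenius_trace d f r)%:~R)) => //.
  by move=> n; rewrite cN newton_algC; apply: eq_bigr => k _; rewrite cN.
rewrite -[LHS]/((npoints g (map_poly phi f))%:Z%:~R).
rewrite (npoints_frobenius_trace oddF mf sf sepf hd phi r0 cE).
by move: (frobenius_trace d f r) tr => t ->; rewrite !rmorphD /= rmorph1.
Qed.

Lemma is_Lpoly_unique L : is_Lpoly g f L -> L = numerator.
Proof.
case=> al [sL DL npL]; pose cC n : algC := (c n)%:~R; pose LC n : algC := (L`_n)%:~R.
apply/polyP=> n; rewrite coef_numerator; apply: (@intr_inj algC).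
have DLC k : LC k = (\prod_(a <- al) (1 - a *: 'X))`_k by rewrite -DL coef_map.
have natr_neq0 k : (0 < k <= n)%N -> k%:R != 0 :> algC.
  by case/andP=> k0 _; rewrite pnatr_eq0 -lt0n.
apply: (@log_derivative_determined _ LC cC (fun r => - \sum_(a <- al) a ^+ r)
  (fun r => (frobenius_trace d f r)%:~R) n natr_neq0) => //.
- rewrite DLC -horner_coef0 horner_prod big1 // => a _.
  by rewrite !hornerE ?mulr0 ?subr0.
- by rewrite /cC /c numerator_coef0.
- by move=> k; rewrite DLC newton_algC; apply: eq_bigr => r _; rewrite DLC.
move=> r /andP[r0 _]; have [E [phi cE]] := finField_extension_exists F r0.
have := npL r E phi r0 cE.
rewrite -[LHS]/((npoints g (map_poly phi f))%:Z%:~R).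
rewrite (npoints_frobenius_trace oddF mf sf sepf hd phi r0 cE).
by move: (frobenius_trace d f r) => t; rewrite !rmorphD /= rmorph1 => /addrI.
Qed.

End OrdinaryCriterion.

(** * Slopes and ordinarity *)

Section Slopes.

Variables (p q : nat) (L : {poly int}) (g : nat).
Hypothesis p_pr : prime p.
Hypothesis logq : (0 < logn p q)%N.
Hypothesis L0 : L`_0 = 1.
Hypothesis sL : size L = (2 * g).+1.
Hypothesis L_last : absz L`_(2 * g) = (q ^ g)%N.
Hypothesis L_sym : forall j, (j <= g)%N -> (absz (L`_(g + j))%R = q ^ j * absz (L`_(g - j))%R)%N.

Let v k := vq p q L`_k.

Let q0 : (0 < q)%N.
Proof. by case: q logq => //; rewrite logn0. Qed.

Let a0 : (0 : rat) < (logn p q)%:R.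
Proof. by rewrite ltr0n. Qed.

Let v_ge0 k : 0 <= v k.
Proof. by rewrite divr_ge0 ?ler0n. Qed.

Let v0 : v 0 = 0.
Proof. by rewrite /v /vq L0 logn1 mul0r. Qed.

Let v_last : v (2 * g) = g%:R.
Proof. by rewrite /v /vq L_last lognX natrM mulfK // gt_eqF. Qed.

Let v_eq0 k : L`_k != 0 -> (v k == 0) = ~~ (p %| absz (L`_k)%R)%N.
Proof.
move=> Lk; rewrite mulf_eq0 invr_eq0 [_ == 0 in X in _ || X]gt_eqF // orbF.
by rewrite pnatr_eq0 -leqn0 leqNgt logn_gt0 mem_primes p_pr absz_gt0 Lk.
Qed.

Let le2g k : L`_k != 0 -> (k <= 2 * g)%N.
Proof. by move=> Lk; rewrite -ltnS -sL; apply: contraNT Lk; rewrite -leqNgt => /(nth_default 0)->. Qed.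

(** By the symmetry of the coefficients, the polygon also lies above the line of slope 1 through (g,
    0). *)
Let v_ge k : L`_k != 0 -> (k%:R - g%:R : rat) <= v k.
Proof.
move=> Lk; have [kg|gk] := leqP k g.
  by apply: le_trans (v_ge0 k); rewrite subr_le0 ler_nat.
have kg : (k - g <= g)%N by have := le2g Lk; lia.
have := L_sym kg; rewrite subnKC ?(ltnW gk) // => Dk.
have Lgk : (0 < absz (L`_(g - (k - g)))%R)%N.
  by rewrite lt0n; apply: contraNneq Lk => z; rewrite -absz_eq0 Dk z muln0.
rewrite /v /vq Dk lognM ?expn_gt0 ?q0 // lognX natrD natrM mulrDl mulfK ?gt_eqF //.
by rewrite natrB ?(ltnW gk) // lerDl divr_ge0 ?ler0n.
Qed.

Lemma slopes_of_unit : ~~ (p %| absz (L`_g)%R)%N ->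
  forall lam, newton_slope p q L lam -> lam = 0 \/ lam = 1.
Proof.
move=> pLg lam [i [j [ij Li Lj Dv lam_min]]].
have {}Dv : v j - v i = lam * (j%:R - i%:R) := Dv.
have {}lam_min k : L`_k != 0 -> v i + lam * (k%:R - i%:R) <= v k := @lam_min k.
have Lg : L`_g != 0 by apply: contraNneq pLg => ->; rewrite absz0 dvdn0.
have vg : v g = 0 by apply/eqP; rewrite v_eq0.
have L2g : L`_(2 * g) != 0 by rewrite -absz_eq0 L_last -lt0n expn_gt0 q0.
have D2g : (2 * g)%:R = g%:R + g%:R :> rat by rewrite mul2n -addnn natrD.
have at0 := lam_min 0%N; rewrite L0 oner_eq0 v0 in at0; move/(_ isT) in at0.
have atg := lam_min g Lg; rewrite vg in atg.
have at2g := lam_min (2 * g)%N L2g; rewrite v_last D2g in at2g.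
have vi := v_ge0 i; have vj := v_ge0 j; have wi := v_ge Li; have wj := v_ge Lj.
have ijR : i%:R < j%:R :> rat by rewrite ltr_nat.
have i0 : 0 <= i%:R :> rat by rewrite ler0n.
have y2G : j%:R <= g%:R + g%:R :> rat by rewrite -D2g ler_nat le2g.
have jgR : (j <= g)%N -> j%:R <= g%:R :> rat by rewrite ler_nat.
have gjR : (g < j)%N -> g%:R < j%:R :> rat by rewrite ltr_nat.
have igR : (i < g)%N -> i%:R < g%:R :> rat by rewrite ltr_nat.
have giR : (g <= i)%N -> g%:R <= i%:R :> rat by rewrite ler_nat.
move: at0 atg at2g Dv wi wj ijR i0 y2G jgR gjR igR giR vi vj.
move: (v i) (v j) (i%:R : rat) (j%:R : rat) (g%:R : rat) => vi vj x y G.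
move=> at0 atg at2g Dv wi wj ijR i0 y2G jgR gjR igR giR vi0 vj0.
(* The points (0, 0), (g, 0) and (2g, g) force slope 0 left of g and slope 1 right of it. An edge
   across g is impossible: its line would be at most 0 at g, hence below j - g at j. *)
have [/jgR yG|/gjR Gy] := leqP j g.
  left; case: (ltrgt0P lam) => // l0; exfalso; nra.
have [/giR Gx|/igR xG] := leqP g i; last by exfalso; nra.
right; case: (ltrgtP lam 1) => // l0; exfalso; nra.
Qed.

(* If the last point at height 0 has abscissa i < g, the edge starting there has
   positive slope, hence slope 1, and its line passes above (2g, g). *)
Lemma unit_of_slopes :
    (forall lam, newton_slope p q L lam -> lam = 0 \/ lam = 1) ->
  ~~ (p %| absz (L`_g)%R)%N.
Proof.
move=> slopes; pose P (k : 'I_(2 * g).+1) := (L`_k != 0) && (v k == 0).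
have P0 : P ord0 by rewrite /P /= L0 v0 eqxx.
have [i /andP[Li /eqP vi] maxi] := arg_maxnP (fun k : 'I_(2 * g).+1 => k : nat) P0.
have [|gi] := ltnP i g; last first.
  have := v_ge Li; rewrite vi subr_le0 ler_nat => ig.
  have Di : i = g :> nat by apply/eqP; rewrite eqn_leq ig.
  by rewrite -Di -v_eq0 // vi.
move=> ig; have L2g : L`_(2 * g) != 0 by rewrite -absz_eq0 L_last -lt0n expn_gt0 q0.
pose P1 (k : 'I_(2 * g).+1) := (L`_k != 0) && (i < k)%N.
pose slope (k : 'I_(2 * g).+1) : rat := v k / (k%:R - i%:R).
have P1max : P1 ord_max by rewrite /P1 /= L2g; lia.
have [j /andP[Lj ij] minj] := Order.TotalTheory.arg_minP slope P1max.
have pos (k : nat) : (i < k)%N -> 0 < k%:R - i%:R :> rat by rewrite subr_gt0 ltr_nat.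
have vpos (k : 'I_(2 * g).+1) : L`_k != 0 -> (i < k)%N -> 0 < v k.
  move=> Lk ik; rewrite lt_neqAle v_ge0 andbT eq_sym; apply/negP=> vk0.
  by have := maxi k; rewrite /P Lk vk0 => /(_ isT); rewrite /geq /= leqNgt ik.
have lam0 : 0 < slope j by rewrite divr_gt0 ?pos ?vpos.
have slope_j : newton_slope p q L (slope j).
  exists i, j; split=> [||||k Lk] //.
    by rewrite -[vq p q L`_j]/(v j) -[vq p q L`_i]/(v i) vi subr0 mulfVK ?gt_eqF ?pos.
  rewrite -[vq p q L`_i]/(v i) -[vq p q L`_k]/(v k) vi add0r.
  have k2g := le2g Lk; have [ki|ik] := leqP k i.
    by apply: le_trans (v_ge0 k); rewrite pmulr_rle0 // subr_le0 ler_nat.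
  rewrite -ler_pdivlMr ?pos //; rewrite -ltnS in k2g.
  by apply: (minj (Ordinal k2g)); rewrite /P1 Lk.
have [lam_0|lam1] := slopes _ slope_j; first by move: lam0; rewrite lam_0 ltxx.
have := minj ord_max P1max; rewrite lam1 /slope /= v_last.
rewrite ler_pdivlMr; last by apply: pos; lia.
by rewrite mul1r lerBlDr -natrD ler_nat; lia.
Qed.

End Slopes.

Lemma ordinary_numerator (F : finFieldType) (g d p : nat) (f : {poly F}) :
    odd #|F| -> f \is monic -> size f = d.+1 -> separable_poly f ->
    d = (2 * g + 1)%N \/ d = (2 * g + 2)%N -> p \in [pchar F] ->
  ordinary p g f <-> ~~ (p %| `|numerator_coef d f g|)%N.
Proof.
move=> oddF mf sf sepf hd pF; have p_pr := pcharf_prime pF.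
pose N := numerator g d f.
have cN n : N`_n = numerator_coef d f n by apply: coef_numerator.
have logF : (0 < logn p #|F|)%N.
  have := finNzRing_gt1 F; rewrite [#|F|](card_pprimeChar pF).
  by rewrite pfactorK //; case: (logn _ _).
have N0 : N`_0 = 1 by rewrite cN numerator_coef0.
have N_last : absz N`_(2 * g) = (#|F| ^ g)%N.
  by rewrite cN (numerator_coef_last_abs oddF mf sf sepf hd).
have N_sym j : (j <= g)%N -> (absz (N`_(g + j))%R = #|F| ^ j * absz (N`_(g - j))%R)%N.
  by rewrite !cN; apply: (numerator_coef_abs oddF mf sf sepf hd).
have sN : size N = (2 * g).+1.
  apply: size_poly_eq; rewrite -cN -absz_eq0 N_last -lt0n expn_gt0.
  by rewrite (ltnW (finNzRing_gt1 F)).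
rewrite -cN; split=> [[L [/(is_Lpoly_unique oddF mf sf sepf hd)-> slopes]]|pN].
  by apply: unit_of_slopes slopes.
exists N; split; first exact: is_Lpoly_numerator.
exact: (slopes_of_unit (g := g)).
Qed.

(** * The Hasse-Witt matrix *)

Lemma char_poly_conj (K : fieldType) n (Q A : 'M[K]_n) : Q \in unitmx ->
  char_poly (Q *m A *m invmx Q) = char_poly A.
Proof.
move=> uQ; rewrite /char_poly /char_poly_mx.
have DQ : map_mx polyC Q *m map_mx polyC (invmx Q) = 1%:M.
  by rewrite -map_mxM mulmxV // map_mx1.
have -> : 'X%:M - map_mx polyC (Q *m A *m invmx Q) =
    map_mx polyC Q *m ('X%:M - map_mx polyC A) *m map_mx polyC (invmx Q).
  rewrite mulmxBr mulmxBl !map_mxM; congr (_ - _).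
  by rewrite scalar_mxC -mulmxA DQ mulmx1.
rewrite !det_mulmx mulrC mulrA -det_mulmx.
by rewrite (mulmx1C DQ) det1 mul1r.
Qed.

Lemma conj_expmx (K : fieldType) n (Q A : 'M[K]_n) r : Q \in unitmx ->
  (Q *m A *m invmx Q) ^+ r = Q *m (A ^+ r) *m invmx Q.
Proof.
move=> uQ; elim: r => [|r IH]; first by rewrite !expr0 mulmx1 mulmxV.
by rewrite !exprS IH -!mulmxE !mulmxA mulmxKV.
Qed.

Lemma char_poly_lblock (R : comNzRingType) n1 n2 (A : 'M[R]_n1) (B : 'M[R]_(n2, n1))
    (D : 'M[R]_n2) :
  char_poly (block_mx A 0 B D) = char_poly A * char_poly D.
Proof.
rewrite /char_poly /char_poly_mx map_block_mx map_mx0 scalar_mx_block.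
by rewrite opp_block_mx add_block_mx oppr0 addr0 det_lblock.
Qed.

(** Deflation: a row eigenvector for one root, completed to a basis, makes the matrix block
    triangular, and both the characteristic polynomial and the traces of powers split off that
    root. *)
Lemma trace_expmx (K : fieldType) n (A : 'M[K]_n) (s : seq K) r :
    char_poly A = \prod_(a <- s) ('X - a%:P) ->
  \tr (A ^+ r) = \sum_(a <- s) a ^+ r.
Proof.
elim: n A s => [|n IH] A s DA.
  have : size s = 0%N by apply/succn_inj; rewrite -(size_prod_XsubC s id) -DA size_char_poly.
  by move/size0nil->; rewrite big_nil /mxtrace big_ord0.
have ss : size s = n.+1 by apply/succn_inj; rewrite -(size_prod_XsubC s id) -DA size_char_poly.
case: s ss DA => // a s _ DA.
have /eigenvalueP[w wA w0] : eigenvalue A a.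
  by rewrite eigenvalue_root_char DA root_prod_XsubC mem_head.
pose Q := row_ebase w; have uQ : Q \in unitmx by apply: row_ebase_unit.
pose B : 'M[K]_(1 + n) := Q *m A *m invmx Q.
have row0 : row 0 B = a *: delta_mx 0 0.
  have rw : \rank w = 1%N by rewrite rank_rV w0.
  have Dw := mulmx_ebase w; rewrite rw -/Q in Dw.
  have Dc : col_ebase w = (col_ebase w 0 0)%:M by apply: mx11_scalar.
  have c0 : col_ebase w 0 0 != 0.
    by apply: contraNneq w0 => c0; rewrite -Dw Dc c0 raddf0 !mul0mx.
  have D1 : (pid_mx 1 : 'M[K]_(1, n.+1)) = delta_mx 0 0.
    by apply/matrixP=> i j; rewrite !mxE !ord1 /= eq_sym andbT.
  rewrite Dc D1 mul_scalar_mx -scalemxAl -rowE in Dw.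
  have Q0 : row 0 Q *m A = a *: row 0 Q.
    apply: (scalerI c0); rewrite scalemxAl Dw wA -{1}Dw.
    by rewrite scalerA mulrC -scalerA.
  by rewrite rowE /B !mulmxA -rowE Q0 -scalemxAl -row_mul mulmxV // row1.
have DB : B = block_mx a%:M 0 (dlsubmx B) (drsubmx B).
  rewrite -[LHS]submxK; congr (block_mx _ _ _ _); apply/matrixP=> i j; rewrite !mxE.
    have /matrixP/(_ 0 (lshift n j)) := row0; rewrite !mxE !ord1 => E.
    rewrite (_ : lshift n 0 = 0) in E *; last exact: val_inj.
    by rewrite E !eqxx mulr1.
  have /matrixP/(_ 0 (rshift 1 j)) := row0; rewrite !mxE !ord1 => E.
  rewrite (_ : lshift n 0 = 0); last exact: val_inj.
  by rewrite E mulr0.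
have DBr : exists u, B ^+ r = block_mx (a ^+ r)%:M 0 u (drsubmx B ^+ r).
  elim: (r) => [|k [u Du]]; first by exists 0; rewrite !expr0 -scalar_mx_block.
  exists (dlsubmx B *m (a ^+ k)%:M + drsubmx B *m u).
  rewrite exprS Du -mulmxE {1}DB (@mulmx_block _ 1 n 1 n 1 n).
  by rewrite !mulmx0 !mul0mx !addr0 add0r -scalar_mxM -!exprS mulmxE -exprS.
have [u Du] := DBr; rewrite big_cons.
have -> : \tr (A ^+ r) = \tr (B ^+ r).
  by rewrite /B conj_expmx // mxtrace_mulC mulmxA mulVmx // mul1mx.
rewrite Du mxtrace_block mxtrace_scalar mulr1n; congr (_ + _); apply: IH.
apply: (mulfI (monic_neq0 (monicXsubC a))).
have := DA; rewrite big_cons => <-; rewrite -(char_poly_conj A uQ) -/B {2}DB.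
rewrite (char_poly_lblock (a%:M : 'M_1) (dlsubmx B) (drsubmx B)); congr (_ * _).
by rewrite /char_poly det_mx11 !mxE eqxx !mulr1n.
Qed.

Lemma expp_coef (R : comNzRingType) p k (h : {poly R}) n : p \in [pchar R] ->
  (h ^+ (p ^ k))`_n = if (p ^ k %| n)%N then h`_(n %/ p ^ k) ^+ (p ^ k) else 0.
Proof.
move=> pR; have p_pr := pcharf_prime pR; have p0 := prime_gt0 p_pr.
have pP : p \in [pchar {poly R}] by rewrite pchar_poly.
have q0 : (0 < p ^ k)%N by rewrite expn_gt0 p0.
have -> : h ^+ (p ^ k) = \poly_(i < size h) (h`_i ^+ (p ^ k)) \Po 'X^(p ^ k).
  rewrite -{1}[h]coefK !poly_def (big_morph _ (expp_morph k pP) (_ : 0 ^+ _ = 0)).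
    rewrite linear_sum /=; apply: eq_bigr => i _.
    by rewrite exprZn linearZ /= comp_Xn_poly -!exprM mulnC.
  by rewrite expr0n gtn_eqF.
rewrite coef_comp_poly_Xn // coef_poly; case: ifP => // _; case: ltnP => // hn.
by rewrite nth_default // expr0n gtn_eqF.
Qed.

(** For Q = p this is the Hasse-Witt (Cartier-Manin) matrix, with exponents Q i - j for i, j counted
    from 1; Q = q^r yields the point counts over the extension of degree r. The subtraction is exact
    when g <= Q. *)
Definition hasse_witt (R : nzRingType) g (f : {poly R}) Q : 'M[R]_g :=
  \matrix_(i, j) (f ^+ Q./2)`_(Q * i.+1 - j.+1).

Lemma size_exp_half (R : idomainType) g d Q (f : {poly R}) :
    size f = d.+1 -> (d <= 2 * g + 2)%N -> odd Q ->
  (size (f ^+ Q./2) <= (g.+1 * Q.-1).+1)%N.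
Proof.
move=> sf dg oddQ; have f0 : f != 0 by rewrite -size_poly_eq0 sf.
have := size_exp f Q./2; rewrite sf /= => sE.
have s0 : (0 < size (f ^+ Q./2))%N by rewrite size_poly_gt0 expf_neq0.
have DQ : (Q = 1 + 2 * Q./2)%N by rewrite -{1}[Q]odd_double_half oddQ mul2n.
rewrite -(prednK s0) sE ltnS {2}DQ /= add0n mulnA leq_mul2r.
by apply/orP; right; rewrite (leq_trans dg) // mulSn; lia.
Qed.

Lemma half_mul_odd P Q : odd P -> odd Q -> ((P * Q)./2 = P./2 + Q./2 * P)%N.
Proof.
move=> oddP oddQ; have DP := odd_double_half P; have DQ := odd_double_half Q.
rewrite oddP -muln2 in DP; rewrite oddQ -muln2 in DQ.
have E : (P * Q = 1 + (P./2 + Q./2 * P) * 2)%N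
  by move: DP DQ; move: P./2 Q./2 => a b <- <-; rewrite /=; ring.
by rewrite E muln2 add1n -[_.*2.+1]/(true + _.*2)%N half_bit_double.
Qed.

(** With P = p^k, f^((PQ - 1)/2) is f^((P - 1)/2) times the P-th power of f^((Q - 1)/2), whose
    exponents are multiples of P. A term of degree t of the first factor thus contributes only if t
    + j = P l (j from 1), and the degree bound forces 1 <= l <= g. *)
Lemma hasse_wittM (R : idomainType) p g d k Q (f : {poly R}) :
    p \in [pchar R] -> odd p -> size f = d.+1 -> (d <= 2 * g + 2)%N ->
    (g < p)%N -> (0 < k)%N -> odd Q -> (g < Q)%N ->
  hasse_witt g f (p ^ k * Q) =
    map_mx (fun x => x ^+ (p ^ k)) (hasse_witt g f Q) *m hasse_witt g f (p ^ k).
Proof.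
move=> pR podd sf dg gp k0 oddQ gQ; set P := (p ^ k)%N.
have oddP : odd P by rewrite oddX podd orbT.
have gP : (g < P)%N by rewrite (leq_trans gp) // -{1}[p]expn1 leq_exp2l ?prime_gt1 ?(pcharf_prime pR).
apply/matrixP=> i j; rewrite !mxE; set N := (_ - _)%N.
have DN : (N + j.+1 = P * (Q * i.+1))%N.
  rewrite /N subnK ?mulnA //; have := ltn_ord j.
  by move: gP gQ; clear; nia.
rewrite (half_mul_odd oddP oddQ) exprD exprM coefM.
have small (l : nat) : (l < g)%N -> (P * l.+1 - j.+1 < N.+1)%N.
  move=> lg; rewrite ltnS leq_sub2r // -mulnA leq_mul2l; apply/orP; right.
  by apply: leq_trans (leq_pmulr _ _) => //; apply: leq_trans gQ; apply: ltnW.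
pose h (l : 'I_g) : 'I_N.+1 := Ordinal (small l (ltn_ord l)).
have Dh l : (h l + j.+1 = P * l.+1)%N.
  by rewrite subnK // (leq_trans (ltn_ord j)) // (leq_trans (ltnW gP)) // leq_pmulr.
pose G (t : 'I_N.+1) := (f ^+ P./2)`_t * (f ^+ Q./2 ^+ P)`_(N - t).
have P0 : (0 < P)%N by apply: leq_trans gP.
transitivity (\sum_t \sum_(l < g | h l == t) G t).
  apply: eq_bigr => t _; rewrite -/(G t).
  have [/existsP[l /eqP hl]|/existsPn nt] := boolP [exists l, h l == t].
    rewrite (big_pred1 l) // => l' /=; rewrite -hl; apply/eqP/eqP => [E|->//].
    have := Dh l; rewrite -E Dh => /eqP; rewrite eqn_pmul2l // eqSS => /eqP E'.
    exact/val_inj.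
  rewrite big_pred0 => [|l]; last exact/negbTE/nt.
  rewrite /G expp_coef //; case: ifP => [Pt|_]; last by rewrite mulr0.
  have [k' Dk] := dvdnP Pt; have tN : (t <= N)%N by rewrite -ltnS.
  have Et : (t + j.+1 = P * (Q * i.+1 - k'))%N.
    by rewrite mulnBr -DN [(P * k')%N]mulnC -Dk; move: tN; lia.
  case Dl : (Q * i.+1 - k')%N => [|l]; first by move: Et; rewrite Dl muln0 addnS.
  rewrite Dl in Et; have [lg|gl] := ltnP l g.
    case/eqP: (nt (Ordinal lg)); apply: val_inj; apply: (@addIn j.+1).
    by rewrite Dh Et.
  rewrite nth_default ?mul0r // (leq_trans (size_exp_half sf dg oddP)) //.
  have : (P * g.+1 <= t + j.+1)%N by rewrite Et leq_mul2l ltnS gl orbT.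
  rewrite -{1}(prednK P0) mulSn [(_ * g.+1)%N]mulnC; have := ltn_ord j.
  by move: (_ * _)%N => m; clear; lia.
rewrite (exchange_big_dep predT) //=; apply: eq_bigr => l _.
rewrite (big_pred1 (h l)) => [|t]; last by rewrite /= eq_sym.
rewrite !mxE /G expp_coef // mulrC.
have Nh : (N - h l = P * (Q * i.+1 - l.+1))%N.
  by rewrite mulnBr -DN -Dh subnDr.
by rewrite Nh dvdn_mulr // mulKn // /h /=.
Qed.

(* The Hasse-Witt matrix of the q-th power Frobenius is a product of Frobenius
   twists of the one for p. *)
Lemma hasse_witt_pow_det (R : idomainType) p g d k (f : {poly R}) :
    p \in [pchar R] -> odd p -> size f = d.+1 -> (d <= 2 * g + 2)%N ->
    (g < p)%N ->
  (\det (hasse_witt g f (p ^ k.+1)) == 0) = (\det (hasse_witt g f p) == 0).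
Proof.
move=> pR podd sf dg gp; have p_pr := pcharf_prime pR.
elim: k => [|k IH]; first by rewrite expn1.
have oddk : odd (p ^ k.+1) by rewrite oddX podd orbT.
have gk : (g < p ^ k.+1)%N.
  by rewrite (leq_trans gp) // -{1}[p]expn1 leq_exp2l ?prime_gt1.
rewrite expnS -{1}[p]expn1 (hasse_wittM pR podd sf dg) // det_mulmx expn1 mulf_eq0.
have -> : map_mx (fun x => x ^+ p) (hasse_witt g f (p ^ k.+1)) =
    map_mx (pFrobenius_aut pR) (hasse_witt g f (p ^ k.+1)).
  by apply: eq_map_mx => x; rewrite pFrobenius_autE.
by rewrite det_map_mx /= pFrobenius_autE expf_eq0 prime_gt0 //= IH orbb.
Qed.

Lemma hasse_witt_exp (F : finFieldType) p g d r (f : {poly F}) :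
    p \in [pchar F] -> odd p -> size f = d.+1 -> (d <= 2 * g + 2)%N ->
    (g < p)%N ->
  hasse_witt g f (#|F| ^ r.+1) = hasse_witt g f #|F| ^+ r.+1.
Proof.
move=> pF podd sf dg gp; have p_pr := pcharf_prime pF.
have [k DF] : exists k, #|F| = (p ^ k.+1)%N.
  have := finNzRing_gt1 F; rewrite [#|F|](card_pprimeChar pF).
  by case: (logn _ _) => // k _; exists k.
elim: r => [|r IH]; first by rewrite expn1 expr1.
have oddr : odd (#|F| ^ r.+1) by rewrite DF -expnM oddX podd orbT.
have gr : (g < #|F| ^ r.+1)%N.
  by rewrite (leq_trans gp) // DF -expnM -{1}[p]expn1 leq_exp2l ?prime_gt1.
rewrite expnS {1}DF (hasse_wittM pF podd sf dg) // -DF IH.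
by rewrite map_mx_id ?mulmxE -?exprSr // => x; apply: expf_card.
Qed.

(** If some y has y^k different from 1, scaling by y shows that the sum vanishes. For k = 0 the sum
    is q = 0, since 0^0 = 1. *)
Lemma sum_expf (E : finFieldType) k :
  \sum_(x : E) x ^+ k = - ((0 < k)%N && (#|E|.-1 %| k)%N)%:R.
Proof.
have [->|k0] := posnP k.
  under eq_bigr => x _ do rewrite expr0.
  by rewrite sumr_const finField_natr_card oppr0.
have E1 := finNzRing_gt1 E; have E0 : (0 < #|E|.-1)%N by case: #|E| E1 => [|[]].
case: (boolP (_ %| k)%N) => [/dvdnP[m Dk]|nk] /=.
  rewrite (bigD1 0) //= expr0n gtn_eqF // add0r (eq_bigr (fun=> 1)) => [|x x0].
    rewrite sumr_const cardC1; apply: (@addIr _ 1).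
    by rewrite -mulrSr prednK ?(ltnW E1) // finField_natr_card addNr.
  by rewrite Dk mulnC exprM expf_card1 // expr1n.
have [y y0 yk] : exists2 y : E, y != 0 & y ^+ k != 1.
  have k'0 : (0 < k %% #|E|.-1)%N by rewrite lt0n.
  have [y /andP[y0 yk]|H] := pickP (fun y : E => (y != 0) && (y ^+ k != 1)).
    by exists y.
  have X0 : 'X^(k %% #|E|.-1) - 1 != 0 :> {poly E}.
    by rewrite -size_poly_eq0 size_XnsubC.
  have := card_lt_size_vanishing X0; rewrite size_XnsubC // ltnS leqNgt ltn_mod E0.
  move=> small; case: notF; apply: small => y y0; rewrite /root !hornerE subr_eq0.
  have := H y; rewrite y0 /= => /negbFE/eqP<-.
  by rewrite {2}(divn_eq k #|E|.-1) exprD mulnC exprM expf_card1 // expr1n mul1r.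
rewrite oppr0; apply: (mulfI (_ : y ^+ k - 1 != 0)); first by rewrite subr_eq0.
rewrite mulr0 mulrBl mul1r mulr_sumr [X in _ - X](reindex_inj (mulfI y0)).
by apply/eqP; rewrite subr_eq0; apply/eqP; apply: eq_bigr => x _; rewrite exprMn.
Qed.

Lemma coef_prod_1subZX (R : comNzRingType) (s : seq R) :
  (\prod_(a <- s) (1 - a *: 'X))`_(size s) = \prod_(a <- s) (- a).
Proof.
have size_le (t : seq R) : (size (\prod_(a <- t) (1 - a *: 'X))%R <= (size t).+1)%N.
  elim: t => [|a t IH]; first by rewrite big_nil size_poly1.
  rewrite big_cons mulrBl mul1r -scalerAl (leq_trans (size_polyD _ _)) //.
  rewrite geq_max (leq_trans IH) //= size_polyN (leq_trans (size_scale_leq _ _)) //.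
  by rewrite mulrC (leq_trans (size_polyMleq _ _)) // size_polyX addn2.
elim: s => [|a s IH]; first by rewrite !big_nil coef1.
rewrite !big_cons mulrBl mul1r -scalerAl coefB coefZ coefXM /= IH.
by rewrite nth_default ?sub0r ?mulNr.
Qed.

Section HasseWittCriterion.

Variables (p g d : nat) (F : finFieldType) (f : {poly F}).
Hypothesis pF : p \in [pchar F].
Hypothesis podd : odd p.
Hypothesis mf : f \is monic.
Hypothesis sf : size f = d.+1.
Hypothesis sepf : separable_poly f.
Hypothesis hd : d = (2 * g + 1)%N \/ d = (2 * g + 2)%N.
Hypothesis gp : (g < p)%N.
Let q := #|F|.

Let p_pr : prime p := pcharf_prime pF.

Let qE : exists k, q = (p ^ k.+1)%N.
Proof.
have := finNzRing_gt1 F; rewrite /q [#|F|](card_pprimeChar pF).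
by case: (logn _ _) => // k _; exists k.
Qed.

Let oddF : odd q.
Proof. by have [k ->] := qE; rewrite oddX podd orbT. Qed.

Let dg : (d <= 2 * g + 2)%N.
Proof. by case: hd => ->; rewrite ?leq_add2l. Qed.

(** By [sum_expf] only the coefficients in degrees (Q - 1) k with 1 <= k <= g + 1 survive. Those
    with k <= g are the diagonal of the matrix; k = g + 1 is the leading coefficient for even d and
    exceeds the degree for odd d. *)
Lemma sum_horner_half (E : finFieldType) (h : {poly E}) : odd #|E| ->
    h \is monic -> size h = d.+1 ->
  \sum_x h.[x] ^+ #|E|./2 = - \tr (hasse_witt g h #|E|) - (~~ odd d)%:R.
Proof.
move=> oddE mh sh; set Q := #|E|; set H := h ^+ Q./2.
have sH : (size H <= (g.+1 * Q.-1).+1)%N by apply: size_exp_half sh dg oddE.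
have E1 := finNzRing_gt1 E; have Q0 : (0 < Q.-1)%N by rewrite /Q; case: #|E| E1 => [|[]].
transitivity (\sum_(k < (g.+1 * Q.-1).+1) H`_k * \sum_(x : E) x ^+ k).
  under [RHS]eq_bigr => k _ do rewrite mulr_sumr.
  rewrite [RHS]exchange_big; apply: eq_bigr => x _.
  by rewrite -horner_exp -/H (horner_coef_wide _ sH).
transitivity (- \sum_(1 <= k < (g.+1 * Q.-1).+1 | (Q.-1 %| k)%N) H`_k).
  rewrite -sumrN [RHS]big_mkcond /= -(big_mkord predT (fun k => H`_k * \sum_(x : E) x ^+ k)).
  rewrite [LHS]big_ltn // (sum_expf E 0) /= oppr0 mulr0 add0r; apply: eq_big_nat => k /andP[k0 _].
  by rewrite sum_expf k0 /=; case: ifP => _; rewrite ?oppr0 ?mulr0 ?mulrN1.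
rewrite -(sum_multiples _ (fun r _ => H`_r)) //.
have -> : \sum_(1 <= k < (g.+1 * Q.-1).+1 | (Q.-1 * k <= g.+1 * Q.-1)%N) H`_(Q.-1 * k) =
    \sum_(1 <= k < g.+2) H`_(Q.-1 * k).
  rewrite [RHS](@big_nat_widen _ _ _ _ _ (g.+1 * Q.-1).+1); last first.
    by rewrite ltnS leq_pmulr.
  by apply: eq_bigl => k; rewrite mulnC leq_pmul2r // ltnS.
rewrite big_nat_recr //= opprD; congr (- _ - _).
  rewrite /mxtrace big_add1 big_mkord; apply: eq_bigr => i _; rewrite mxE /= -/Q -/H.
  by rewrite -subn1 mulnBl mul1n.
have DQ : (Q./2 * 2 = Q.-1)%N by rewrite muln2 card_half_double.
have mH : H \is monic by apply: monic_exp.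
have sHE : size H = (d * Q./2).+1.
  have := size_exp h Q./2; rewrite -/H sh /= => <-.
  by rewrite prednK // size_poly_gt0 monic_neq0.
case: (boolP (odd d)) => oddd.
  have Dd : d = (2 * g + 1)%N by move: oddd; case: hd; lia.
  by rewrite nth_default // sHE Dd -DQ; move: DQ Q0; move: Q./2 => a; nia.
have Dd : d = (2 * g + 2)%N by move: oddd; case: hd; lia.
have -> : (Q.-1 * g.+1 = (size H).-1)%N by rewrite sHE Dd -DQ /=; ring.
by rewrite -lead_coefE (monicP mH).
Qed.

(** The 1 added to the trace for even d cancels the leading coefficient in [sum_horner_half]. *)
Lemma frobenius_trace_mod r : (0 < r)%N ->
  (frobenius_trace d f r)%:~R = - \tr (hasse_witt g f (q ^ r)).
Proof.
move=> r0; have [E [phi cE]] := finField_extension_exists F r0.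
have oddE : odd #|E| by rewrite cE oddX oddF orbT.
apply: (fmorph_inj phi); rewrite rmorph_int rmorphN /= -trace_map_mx.
rewrite /frobenius_trace -(sum_qchar_horner mf oddF phi r0 cE) rmorphD rmorph_sum /=.
under eq_bigr => x _ do rewrite qchar_exp //.
rewrite sum_horner_half ?map_monic ?size_map_poly // cE.
have -> : map_mx phi (hasse_witt g f (q ^ r)) = hasse_witt g (map_poly phi f) (q ^ r).
  by apply/matrixP=> i j; rewrite !mxE -rmorphXn coef_map.
by case: odd; rewrite /= ?add0r ?subr0 // addrC subrK.
Qed.

Lemma numerator_coef_mod :
  (numerator_coef d f g)%:~R = (-1) ^+ g * \det (hasse_witt g f q).
Proof.
set M := hasse_witt g f q; have M0 : char_poly M != 0 by apply/monic_neq0/char_poly_monic.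
have [L [phi [s Ds]]] : exists (L : fieldType) (phi : {rmorphism F -> L}) (s : seq L),
    map_poly phi (char_poly M) %= \prod_(a <- s) ('X - a%:P).
  by have [L [s Ds _]] := FinSplittingFieldFor M0; exists L, (in_alg L), s.
have DM : char_poly (map_mx phi M) = \prod_(a <- s) ('X - a%:P).
  apply/eqP; rewrite -map_char_poly -eqp_monic ?map_monic ?char_poly_monic //.
  exact: monic_prod_XsubC.
have ss : size s = g.
  by apply/succn_inj; rewrite -(size_prod_XsubC s id) -DM size_char_poly.
apply: (fmorph_inj phi); rewrite rmorph_int rmorphM rmorphXn rmorphN1 /= -det_map_mx.
rewrite -char_poly_det DM -horner_coef0 horner_prod.
under eq_bigr => a _ do rewrite hornerXsubC sub0r.
rewrite -coef_prod_1subZX ss.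
have pL : p \in [pchar L] by rewrite (fmorph_pchar phi).
have k_neq0 k : (0 < k <= g)%N -> k%:R != 0 :> L.
  case/andP=> k0 kg; rewrite -(dvdn_pcharf pL); apply/negP=> /(dvdn_leq k0).
  by rewrite leqNgt (leq_ltn_trans kg).
apply: (log_derivative_determined (c := fun n => (numerator_coef d f n)%:~R)
  (c' := fun n => (\prod_(a <- s) (1 - a *: 'X))`_n)
  (t := fun r => (frobenius_trace d f r)%:~R) (t' := fun r => - \sum_(a <- s) a ^+ r) k_neq0).
- by rewrite numerator_coef0.
- by rewrite -horner_coef0 horner_prod big1 // => a _; rewrite !hornerE ?mulr0 ?subr0.
- move=> n; have := numerator_rec oddF mf sf sepf hd n => /(congr1 (fun x : int => x%:~R : L)).
  by rewrite raddfMn rmorph_sum => ->; apply: eq_bigr => r _; exact: rmorphM.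
- by move=> n; rewrite newton_identity -sumrN; apply: eq_bigr => r _; rewrite mulNr.
move=> [|r] // _; rewrite -(trace_expmx r.+1 DM) -(rmorph_int phi) frobenius_trace_mod //.
rewrite (hasse_witt_exp _ pF podd sf dg gp) rmorphN /= -trace_map_mx; congr (- \tr _).
by rewrite -/M; elim: (r) => [|k IH]; rewrite ?expr1 // exprS map_mxM IH [RHS]exprS.
Qed.

Lemma ordinary_hasse_witt : ordinary p g f <-> \det (hasse_witt g f p) != 0.
Proof.
rewrite (ordinary_numerator oddF mf sf sepf hd pF) (dvdn_pcharf pF).
have -> : (`|numerator_coef d f g|%:R == 0 :> F) = ((numerator_coef d f g)%:~R == 0 :> F).
  by case: (numerator_coef d f g) => n //; rewrite NegzE abszN rmorphN oppr_eq0.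
rewrite numerator_coef_mod mulf_eq0 signr_eq0 /=; have [k ->] := qE.
by rewrite (hasse_witt_pow_det k pF podd sf dg gp).
Qed.

End HasseWittCriterion.

(** * Generic invertibility of the Hasse-Witt matrix of the trinomial *)

Lemma coef_XnD1_exp (R : comNzRingType) d M k : (0 < d)%N ->
  (('X^d + 1 : {poly R}) ^+ M)`_k = if (d %| k)%N then 'C(M, k %/ d)%:R else 0.
Proof.
move=> d0; have -> : ('X^d + 1 : {poly R}) ^+ M = (('X + 1) ^+ M) \Po 'X^d.
  by rewrite rmorphXn /= comp_polyD comp_polyX comp_polyC.
rewrite coef_comp_poly_Xn //; case: ifP => // _; rewrite addrC exprDn coef_sum.
under eq_bigr => i _ do rewrite expr1n mul1r coefMn coefXn.
have [kM|Mk] := leqP (k %/ d) M.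
  rewrite (bigD1 (Ordinal (kM : (k %/ d < M.+1)%N))) //= eqxx big1 ?addr0 // => i.
  by rewrite -val_eqE eq_sym /= => /negPf->; rewrite mul0rn.
rewrite bin_small // big1 // => i _; rewrite gtn_eqF ?mul0rn //.
by apply: leq_ltn_trans Mk; rewrite -ltnS.
Qed.

(** Here b counts the factors that contribute s x, and (N - b) / d those that contribute x^d. *)
Lemma coef_trinomial_exp (R : comNzRingType) d m N : (0 < d)%N ->
  (trinomial d ('X : {poly R}) 1 ^+ m)`_N =
    \poly_(b < m.+1) (if (b <= N)%N && (d %| N - b)%N
       then ('C(m, b) * 'C(m - b, (N - b) %/ d))%N%:R else 0).
Proof.
move=> d0; rewrite poly_def.
have -> : trinomial d ('X : {poly R}) 1 = 'X^d + 1 + ('X : {poly R}) *: 'X.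
  by rewrite /trinomial addrAC polyC1.
rewrite exprDn coef_sum; apply: eq_bigr => b _.
rewrite exprZn -scalerAr coefMn coefZ coefMXn ltnNge; case: (b <= N)%N; last first.
  by rewrite /= mulr0 mul0rn scale0r.
rewrite coef_XnD1_exp //=; case: ifP => _; last by rewrite mulr0 mul0rn scale0r.
by rewrite -polyC_natr -mulrnAl mulrC mul_polyC -scaler_nat scalerA -natrM mulnC.
Qed.

Lemma natr_ffact (R : comNzRingType) n k :
  (n ^_ k)%:R = \prod_(l < k) (n%:R - l%:R) :> R.
Proof.
elim: k => [|k IH]; first by rewrite big_ord0.
rewrite big_ord_recr /= -IH ffactnSr natrM; have [kn|nk] := leqP k n.
  by rewrite natrB.
by rewrite ffact_small // !mul0r.
Qed.

Lemma bin_bin_ffact m a r j g : (0 < r)%N -> (j < g)%N -> (a + r <= m + g)%N ->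
  let b := (r - j.+1)%N in let n := (m + g - (a + r))%N in
  ((if (j < r)%N then 'C(m, b) * 'C(m - b, a) else 0) * (a`! * r.-1`! * n`!)
    = m`! * (r.-1 ^_ j * n ^_ (g - j.+1)))%N.
Proof.
move=> r0 jg ar b n; case: ltnP => jr; last first.
  by rewrite (ffact_small (n := r.-1)) ?mul0n ?mul0n ?muln0 // -ltnS prednK.
have [abm|mab] := leqP (a + b) m; last first.
  rewrite [n ^_ _]ffact_small ?muln0; last by rewrite /n /b in mab *; lia.
  have [bm|mb] := leqP b m; last by rewrite bin_small // !mul0n.
  by rewrite ['C(m - b, a)]bin_small ?muln0 // ltn_subLR // addnC.
have Er : (r.-1 ^_ j * b`! = r.-1`!)%N.
  have -> : b = (r.-1 - j)%N by rewrite /b -subn1 subnAC subnS -subn1 subnAC.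
  by apply: ffact_fact; rewrite -ltnS prednK.
have En : (n ^_ (g - j.+1) * (m - b - a)`! = n`!)%N.
  have -> : (m - b - a = n - (g - j.+1))%N by rewrite /n /b; rewrite /b in abm; lia.
  by apply: ffact_fact; rewrite /n; rewrite /b in abm; lia.
have bm : (b <= m)%N by apply: leq_trans abm; apply: leq_addl.
have E1 := bin_fact bm; have abm' : (a <= m - b)%N by rewrite leq_subRL // addnC.
have E2 := bin_fact abm'.
by rewrite -Er -En -E1 -E2; ring.
Qed.

Section Nonvanishing.

Variables (p g d : nat) (K : fieldType).
Hypothesis hg : (2 <= g)%N.
Hypothesis hd : d = (2 * g + 1)%N \/ d = (2 * g + 2)%N.
Hypothesis pK : p \in [pchar K].
Hypothesis hP : (Pplus d < p)%N.

Let p_pr : prime p := pcharf_prime pK.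

Let Pplus_bound :
  (d = 2 * g + 1 /\ 4 * (g * g) < p + 4 * g + 1 \/ d = 2 * g + 2 /\ 2 * (g * g) + g < p)%N.
Proof.
case: hd hP => Dd; rewrite /Pplus => small; [left | right]; split=> //.
  by move: small; rewrite ifT; [rewrite Dd; nia | lia].
move: small; rewrite ifF; last by lia.
have -> : (d ^ 2 - 3 * d + 2 = (2 * (g * g) + g) * 2)%N by rewrite Dd; nia.
by rewrite mulnK.
Qed.

Let dp : (d < p)%N.
Proof. by case: Pplus_bound => -[-> ]; move: hg; nia. Qed.

Let d0 : (0 < d)%N.
Proof. by case: hd => ->; rewrite addnS. Qed.

Let podd : odd p.
Proof.
case: (even_prime p_pr) => // p2; move: dp; rewrite p2; move: hg.
by case: hd => ->; lia.
Qed.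

Let gd : (g < d)%N.
Proof. by case: hd => ->; lia. Qed.

Let natr_neq0 n : (0 < n < p)%N -> n%:R != 0 :> K.
Proof.
case/andP=> n0 np; rewrite -(dvdn_pcharf pK); apply/negP=> /(dvdn_leq n0).
by rewrite leqNgt np.
Qed.

Let natr_inj m n : (m < p)%N -> (n < p)%N -> m%:R = n%:R :> K -> m = n.
Proof.
wlog mn : m n / (m <= n)%N => [W mp np E|mp np E].
  by case/orP: (leq_total m n) => mn; [apply: W | apply/esym/W].
have [//|nm] := eqVneq m n; have : (n - m)%:R != 0 :> K.
  by rewrite natr_neq0 // subn_gt0 ltn_neqAle nm mn (leq_ltn_trans (leq_subr _ _)).
by rewrite natrB // E subrr eqxx.
Qed.

Let m := p./2.

Let Dp : p = (2 * m + 1)%N.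
Proof. by rewrite -{1}[p]odd_double_half podd addnC mul2n. Qed.

Let r (i : 'I_g) := (p * i.+1 %% d)%N.
Let a (i : 'I_g) := (p * i.+1 %/ d)%N.

Let Dar i : (a i * d + r i = p * i.+1)%N.
Proof. by rewrite /a /r -divn_eq. Qed.

Let rd i : (r i < d)%N.
Proof. by rewrite ltn_mod. Qed.

Let coprime_pd : coprime d p.
Proof.
by rewrite coprime_sym prime_coprime //; apply/negP=> /(dvdn_leq d0); rewrite leqNgt dp.
Qed.

Let r0 i : (0 < r i)%N.
Proof.
rewrite lt0n; apply/negP=> /eqP/eqP; rewrite -/(dvdn d _) Gauss_dvdr //.
by move/(dvdn_leq (ltn0Sn _)); rewrite leqNgt (leq_trans _ gd) // ltnS ltn_ord.
Qed.

Let r_inj : injective r.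
Proof.
move=> i j; wlog ij : i j / (i <= j)%N => [W E|].
  by case/orP: (leq_total i j) => ij; [apply: W | apply/esym/W].
move/eqP; rewrite eq_sym eqn_mod_dvd ?leq_mul2l ?ltnS ?ij ?orbT //.
rewrite -mulnBr Gauss_dvdr // subSS; case: (posnP (j - i)) => [|ij0].
  by move/eqP; rewrite subn_eq0 => ji _; apply/val_inj/eqP; rewrite eqn_leq ij.
move/(dvdn_leq ij0); rewrite leqNgt (leq_ltn_trans (leq_subr _ _)) //.
exact: ltn_trans gd.
Qed.

(** Origin of P^+(d). Otherwise 2 (a + r) >= p + 2g + 1; multiplying by d and using a d + r = p (i +
    1) <= p g and r <= d - 1 gives p <= P^+(d), for both parities of d. *)
Let ar_le i : (a i + r i <= m + g)%N.
Proof.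
rewrite leqNgt; apply/negP=> big; have E := Dar i; have ig := ltn_ord i.
have rd1 := rd i; have ip : (p * i.+1 <= p * g)%N by rewrite leq_mul2l ig orbT.
have big2 : (p + 2 * g + 1 <= 2 * (a i + r i))%N by move: big Dp; lia.
have {}big2 : (d * (p + 2 * g + 1) <= d * (2 * (a i + r i)))%N by rewrite leq_mul2l big2 orbT.
have {}E : (d * (2 * (a i + r i)) + 2 * r i = 2 * (p * i.+1) + 2 * (d * r i))%N.
  by rewrite -E; ring.
move: (a i) (r i) (p * i.+1)%N big big2 E rd1 ip => a' r' pi _ big2 E rd1 ip.
case: Pplus_bound => -[Dd small]; rewrite Dd in big2 E rd1.
  have : (g * r' <= g * (2 * g))%N by rewrite leq_mul2l; apply/orP; right; lia.
  move: big2 E ip small; clear; nia.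
have : (g * r' <= g * (2 * g + 1))%N by rewrite leq_mul2l; apply/orP; right; lia.
by move: big2 E ip small rd1; clear; nia.
Qed.

(* In characteristic p one has m = -1/2 and a = -r/d, which makes
   m + g - (a + r) linear in r. *)
Let al : K := d%:R^-1 - 1.
Let be : K := g%:R - 2%:R^-1.

Let d_neq0 : d%:R != 0 :> K.
Proof. by rewrite natr_neq0 // d0 dp. Qed.

Let two_neq0 : 2%:R != 0 :> K.
Proof. by rewrite natr_neq0 //; move: dp gd hg; lia. Qed.

Let Dn i : (m + g - (a i + r i))%:R = al * (r i)%:R + be.
Proof.
have Em : m%:R = - 2%:R^-1 :> K.
  apply: (mulfI two_neq0); rewrite mulrN mulfV //; apply/eqP.
  by rewrite -addr_eq0 -natrM -[1]/(1%:R) -natrD -Dp (pcharf0 pK).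
have Ea : (a i)%:R = - (r i)%:R / d%:R :> K.
  apply: (mulIf d_neq0); rewrite mulfVK //; apply/eqP.
  by rewrite -addr_eq0 -natrM -natrD Dar natrM (pcharf0 pK) mul0r.
rewrite natrB ?ar_le // !natrD Em Ea /al /be.
move: two_neq0 d_neq0; move: (2%:R : K) (d%:R : K) ((r i)%:R : K) (g%:R : K) => t u x y.
by move=> t0 u0; field; rewrite t0 u0.
Qed.

Let P (j : 'I_g) : {poly K} :=
  (\prod_(l < j) ('X - (1 + l%:R)%:P)) * \prod_(l < g - j.+1) (al *: 'X + (be - l%:R)%:P).

Let horner_P j (y : K) : (P j).[y] =
  (\prod_(l < j) (y - 1 - l%:R)) * \prod_(l < g - j.+1) (al * y + be - l%:R).
Proof.
rewrite hornerM !horner_prod; congr (_ * _); apply: eq_bigr => l _.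
  by rewrite hornerXsubC opprD addrA.
by rewrite hornerD hornerZ hornerX hornerC addrA.
Qed.

Let horner_P_r i j :
  (P j).[(r i)%:R] = ((r i).-1 ^_ j * (m + g - (a i + r i)) ^_ (g - j.+1))%:R.
Proof.
rewrite horner_P natrM !natr_ffact Dn; congr (_ * _); apply: eq_bigr => l _.
by rewrite -subn1 natrB ?r0.
Qed.

Let size_P j : (size (P j) <= g)%N.
Proof.
have size_lin (c e : K) : (size (c *: 'X + e%:P)%R <= 2)%N.
  rewrite (leq_trans (size_polyD _ _)) // geq_max (leq_trans (size_scale_leq _ _)) ?size_polyX //.
  by rewrite (leq_trans (size_polyC_leq1 _)).
have size_prod n (G : nat -> {poly K}) : (forall l, size (G l) <= 2)%N ->
    (size (\prod_(l < n) G l)%R <= n.+1)%N.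
  move=> G2; elim: n => [|n IH]; first by rewrite big_ord0 size_poly1.
  rewrite big_ord_recr /= (leq_trans (size_polyMleq _ _)) //.
  by have := leq_add IH (G2 n); rewrite addn2; case: (_ + _)%N.
rewrite (leq_trans (size_polyMleq _ _)) //.
have S1 := size_prod j (fun l => 'X - (1 + l%:R)%:P) (fun l => eq_leq (size_XsubC _)).
have S2 := size_prod (g - j.+1)%N (fun l => al *: 'X + (be - l%:R)%:P) (fun l => size_lin _ _).
rewrite -subn1 leq_subLR (leq_trans (leq_add S1 S2)) //.
by have := ltn_ord j; lia.
Qed.

(** The second factor does not depend on the nodes [x], so it can be tested at convenient ones. *)
Let det_P (x : 'I_g -> K) : \det (\matrix_(i, j) (P j).[x i]) =
  \det (Vandermonde g (\row_i x i)) * \det (\matrix_(k, j) (P j)`_k : 'M_g).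
Proof.
rewrite -[\det (Vandermonde _ _)]det_tr -det_mulmx; congr (\det _).
apply/matrixP=> i j; rewrite !mxE (horner_coef_wide _ (size_P j)).
by apply: eq_bigr => k _; rewrite !mxE mulrC.
Qed.

(** With g = e + l + i + 1, a factor of the second product times 2d is [M]. For d = 2g + 1 its
    maximum, at e = g - 1 and i = 0, is exactly P^+(d). For d = 2g + 2 the factor 2 is split off
    first, as [M] itself may exceed p. *)
Let diag_neq0 (i : 'I_g) : (P i).[i.+1%:R] != 0.
Proof.
rewrite horner_P mulf_neq0 //; apply/prodf_neq0 => l _.
  rewrite -natr1 addrK -natrB ?(ltnW (ltn_ord l)) // natr_neq0 // subn_gt0 ltn_ord.
  by rewrite (leq_ltn_trans (leq_subr _ _)) // (ltn_trans (ltn_ord i)) // (ltn_trans gd dp).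
pose e := (g - l - i.+1)%N.
have lg : (l < g - i.+1)%N := ltn_ord l.
have De : (e + l + i.+1 = g)%N by rewrite /e; lia.
have e0 : (0 < e)%N by rewrite /e; lia.
clearbody e; have eg : (e + i.+1 <= g)%N by move: De; lia.
pose M := (d * (2 * e - 1) + 2 * i.+1)%N.
have DM : (al * i.+1%:R + be - l%:R) * (2%:R * d%:R) = M%:R.
  have Dg : g%:R = e%:R + l%:R + i.+1%:R :> K by rewrite -!natrD De.
  have -> : M%:R = d%:R * (2%:R * e%:R - 1) + 2%:R * i.+1%:R :> K.
    by rewrite natrD !natrM natrB ?muln_gt0 // natrM.
  rewrite /al /be Dg; move: two_neq0 d_neq0.
  move: (2%:R : K) (d%:R : K) (e%:R : K) (l%:R : K) (i.+1%:R : K) => t u x y z t0 u0.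
  by field; rewrite t0 u0.
suff M0 : M%:R != 0 :> K by apply: contraNneq M0 => z; rewrite -DM z mul0r.
case: Pplus_bound => -[Dd small].
  rewrite natr_neq0 // /M Dd; apply/andP; split; first by rewrite addn_gt0 orbT.
  by move: hg e0 eg small (ltn0Sn i); move: i.+1 => y; clear; nia.
have -> : M = (2 * (g.+1 * (2 * e - 1) + i.+1))%N by rewrite /M Dd; ring.
rewrite natrM mulf_neq0 // natr_neq0 //; apply/andP; split; first by rewrite addnS.
by move: hg e0 eg small (ltn0Sn i); move: i.+1 => y; clear; nia.
Qed.

Let det_P_neq0 (x : 'I_g -> K) : injective x -> \det (\matrix_(i, j) (P j).[x i]) != 0.
Proof.
move=> x_inj; rewrite det_P mulf_neq0 //.
  rewrite det_Vandermonde; apply/prodf_neq0 => i _; apply/prodf_neq0 => j ij.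
  by rewrite !mxE subr_eq0 (inj_eq x_inj) -val_eqE gtn_eqF.
have : \det (\matrix_(i, j) (P j).[(i : 'I_g).+1%:R]) != 0.
  rewrite det_trig; first by apply/prodf_neq0 => i _; rewrite mxE diag_neq0.
  (* For i < j the factor l = i of the first product vanishes at i + 1. *)
  apply/is_trig_mxP => i j ij; rewrite mxE horner_P (bigD1 (Ordinal ij)) //=.
  by rewrite -natr1 addrK subrr !mul0r.
by rewrite (det_P (fun i : 'I_g => i.+1%:R)) mulf_eq0 negb_or => /andP[].
Qed.

Let fact_neq0 n : (n < p)%N -> n`!%:R != 0 :> K.
Proof.
elim: n => [|n IH] np; first by rewrite fact0 oner_neq0.
by rewrite factS natrM mulf_neq0 ?IH ?(ltnW np) // natr_neq0.
Qed.

(* The lowest order term in s of the (i, j) entry is s^(r_i - j) (1-based j), so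
   the determinant has the order predicted by its rows, with a leading
   coefficient which is a minor of binomial type. *)
Lemma hasse_witt_trinomial_neq0 :
  \det (hasse_witt g (trinomial d ('X : {poly K}) 1) p) != 0.
Proof.
set A := hasse_witt _ _ _.
(* Once column j is multiplied by s^(j+1), all exponents of s in row i are congruent to r_i modulo
   d, so s^(r_i) divides the row. *)
have DA i j k : (A i j * 'X^(j.+1))`_k =
    if (j < k <= p * i.+1)%N && (d %| p * i.+1 - k)%N
    then ('C(m, k - j.+1) * 'C(m - (k - j.+1), (p * i.+1 - k) %/ d))%N%:R else 0.
  rewrite coefMXn ltnS leqNgt; case: ltnP => //= jk.
  rewrite mxE coef_trinomial_exp // coef_poly.
  have jp : (j.+1 <= p * i.+1)%N.
    by rewrite (leq_trans (ltn_ord j)) // (leq_trans (ltnW (ltn_trans gd dp))) // leq_pmulr.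
  have -> : (p * i.+1 - j.+1 - (k - j.+1) = p * i.+1 - k)%N by rewrite subnBA // subnK.
  rewrite leq_sub2rE //.
  case: ltnP => // mk; case: ifP => // _.
  by rewrite bin_small ?mul0n // ltnNge -ltnS.
have low i j k : (k < r i)%N -> (A i j * 'X^(j.+1))`_k = 0.
  move=> kr; rewrite DA; case: ifP => // /andP[/andP[_ kp] dk].
  have : (r i = k %[mod d])%N by rewrite /r modn_mod; apply/eqP; rewrite eqn_mod_dvd.
  rewrite !modn_small ?rd ?(ltn_trans kr) ?rd // => E.
  by move: kr; rewrite E ltnn.
clearbody A; pose Bt := \matrix_(i, j) drop_poly (r i) (A i j * 'X^(j.+1)).
have DBt : A *m diag_mx (\row_j 'X^(j.+1)) = diag_mx (\row_i 'X^(r i)) *m Bt.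
  rewrite mul_mx_diag mul_diag_mx; apply/matrixP=> i j.
  have T0 : take_poly (r i) (A i j * 'X^(j.+1)) = 0.
    by apply/polyP=> k; rewrite coef_take_poly coef0; case: ltnP => // /low->.
  by rewrite !mxE -{1}[A i j * _](poly_take_drop (r i)) T0 add0r mulrC.
(* Constant terms of the divided rows. Entries with r_i <= j are 0, in agreement with the falling
   factorial of r_i - 1. *)
pose B : 'M[K]_g := map_mx (horner_eval 0) Bt.
have DB i j : B i j = (if (j < r i)%N
    then 'C(m, r i - j.+1) * 'C(m - (r i - j.+1), a i) else 0)%N%:R.
  have rp : (r i <= p * i.+1)%N by rewrite -Dar leq_addl.
  rewrite !mxE horner_evalE horner_coef0 coef_drop_poly add0n DA rp andbT.
  have -> : (p * i.+1 - r i = a i * d)%N by rewrite -Dar addnK.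
  by rewrite dvdn_mull // mulnK // andbT; case: ifP.
have det0 : \det Bt = 0 -> \det B = 0 by move=> Bt0; rewrite det_map_mx Bt0 rmorph0.
clearbody B; pose rho i : K := ((a i)`! * (r i).-1`! * (m + g - (a i + r i))`!)%:R.
have DP : diag_mx (\row_i rho i) *m B = m`!%:R *: \matrix_(i, j) (P j).[(r i)%:R].
  apply/matrixP=> i j; rewrite mul_diag_mx !mxE DB horner_P_r -!natrM.
  by rewrite mulnC bin_bin_ffact.
have detB : \det B != 0.
  have : \det (diag_mx (\row_i rho i) *m B) != 0.
    rewrite DP detZ mulf_neq0 ?expf_neq0 ?fact_neq0 //; first by move: Dp; lia.
    apply: det_P_neq0 => i j E; apply: r_inj.
    by apply: natr_inj E; apply: ltn_trans dp.
  by rewrite det_mulmx mulf_eq0 negb_or => /andP[].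
apply: contraNneq detB => A0; have := congr1 determinant DBt.
rewrite !det_mulmx A0 mul0r det_diag => /esym/eqP; rewrite mulf_eq0.
have /negPf-> /= : \prod_i (\row_i 'X^(r i) : 'rV[{poly K}]_g) 0 i != 0.
  by apply/prodf_neq0 => i _; rewrite mxE monic_neq0 ?monicXn.
by move=> /eqP/det0->.
Qed.

End Nonvanishing.

(** * Specialisation of the family over Z[s, t] *)

Lemma size_trinomial (R : nzRingType) d (s t : R) : (1 < d)%N ->
  size (trinomial d s t) = d.+1.
Proof.
move=> d1; rewrite /trinomial -addrA size_polyDl ?size_polyXn // ltnS.
rewrite (leq_trans (size_polyD _ _)) // geq_max.
rewrite (leq_trans (size_scale_leq _ _)) ?size_polyX //.
by rewrite (leq_trans (size_polyC_leq1 _)) // ltnW.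
Qed.

Lemma monic_trinomial (R : nzRingType) d (s t : R) : (1 < d)%N ->
  trinomial d s t \is monic.
Proof.
move=> d1; rewrite monicE lead_coefE size_trinomial //= !coefD coefXn coefZ coefX coefC.
by rewrite eqxx !gtn_eqF ?(ltnW d1) // mulr0 !addr0.
Qed.

Lemma map_trinomial (R S : nzRingType) (phi : {rmorphism R -> S}) d s t :
  map_poly phi (trinomial d s t) = trinomial d (phi s) (phi t).
Proof. by rewrite !rmorphD /= map_polyXn map_polyZ map_polyX map_polyC. Qed.

Lemma map_hasse_witt (R S : nzRingType) (phi : {rmorphism R -> S}) g f Q :
  map_mx phi (hasse_witt g f Q) = hasse_witt g (map_poly phi f) Q.
Proof. by apply/matrixP=> i j; rewrite !mxE -rmorphXn coef_map. Qed.

Lemma eval_st_morphism (R : comNzRingType) (s t : R) :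
  exists phi : {rmorphism {poly {poly int}} -> R},
    [/\ forall P, phi P = eval_st P s t, phi 'X = s & phi 'Y = t].
Proof.
exists (horner_eval t \o (horner_eval s%:P \o map_poly (map_poly (intr : int -> R)))).
split=> //=; rewrite /horner_eval.
  by rewrite map_polyX hornerX hornerC.
by rewrite map_polyC /= map_polyX hornerC hornerX.
Qed.

Lemma eval_st_poly (R : comNzRingType) (t : R) :
  exists psi : {rmorphism {poly int} -> R},
    psi 'X = t /\ forall P s, eval_st P s t = (map_poly psi P).[s].
Proof.
exists (horner_eval t \o map_poly (intr : int -> R)); split=> [|P s] /=.
  by rewrite /horner_eval map_polyX hornerX.
rewrite (map_poly_comp (horner_eval t)) /eval_st -[in RHS](hornerC s t).
by rewrite -[s%:P.[t]]/(horner_eval t s%:P) horner_map.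
Qed.

Lemma eval_hasse_witt (R : comNzRingType) g d p (s t : R) :
  eval_st (\det (hasse_witt g (trinomial d 'X 'Y) p)) s t =
    \det (hasse_witt g (trinomial d s t) p).
Proof.
have [phi [<- phiX phiY]] := eval_st_morphism s t.
by rewrite -det_map_mx map_hasse_witt map_trinomial phiX phiY.
Qed.

(** The leading coefficients 1 and d stay nonzero in K, so the resultant commutes with
    specialisation. *)
Lemma eval_disc_st (K : fieldType) d (s t : K) : (1 < d)%N -> d%:R != 0 :> K ->
  (eval_st (disc_st d) s t != 0) = separable_poly (trinomial d s t).
Proof.
move=> d1 dK; have [phi [<- phiX phiY]] := eval_st_morphism s t.
rewrite /disc_st /monic_disc; set T : {poly {poly {poly int}}} := trinomial d 'X 'Y.
have mT : T \is monic := monic_trinomial _ _ d1.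
have sT : size T = d.+1 by apply: size_trinomial.
have cT : T^`()`_d.-1 = d%:R.
  by rewrite coef_deriv prednK ?(ltnW d1) //; have := monicP mT; rewrite lead_coefE sT => ->.
have d_neq0 : d%:R != 0 :> {poly {poly int}}.
  by rewrite -!polyC_natr !polyC_eq0 pnatr_eq0 gtn_eqF // ltnW.
have lT' : lead_coef T^`() = d%:R.
  rewrite -cT lead_coefE; congr (_`_ _); congr predn; apply/eqP.
  rewrite eqn_leq; apply/andP; split.
    by rewrite -ltnS -sT lt_size_deriv // -size_poly_eq0 sT.
  by rewrite leqNgt; apply/negP=> small; move: d_neq0; rewrite -cT nth_default ?eqxx // -ltnS prednK // ltnW.
rewrite rmorphM rmorphXn rmorphN1 mulf_eq0 signr_eq0 /=.
rewrite map_resultant; last 2 first.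
- by rewrite (monicP mT) rmorph1 oner_eq0.
- by rewrite lT' rmorph_nat.
rewrite resultant_eq0 -deriv_map map_trinomial phiX phiY unlock /coprimep.
set h := gcdp _ _; have h0 : (0 < size h)%N.
  rewrite size_poly_gt0 gcdp_eq0 negb_and monic_neq0 ?monic_trinomial //.
by case: (size h) h0 => [|[|n]].
Qed.

Lemma separable_XnD1 (K : fieldType) d : (1 < d)%N -> d%:R != 0 :> K ->
  separable_poly (trinomial d 0 1 : {poly K}).
Proof.
move=> d1 dK; rewrite /trinomial scale0r addr0 unlock derivD derivC addr0 derivXn.
rewrite -scaler_nat coprimepZr // coprimep_sym coprimep_expl //.
by rewrite coprimep_sym coprimepX rootE hornerD hornerXn hornerC expr0n gtn_eqF ?(ltnW d1) // add0r oner_eq0.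
Qed.

Theorem corollary4p3 (g d p : nat) (hg : (2 <= g)%N)
    (hd : d = (2 * g + 1)%N \/ d = (2 * g + 2)%N)
    (hp : prime p) (hP : (Pplus d < p)%N) :
  generically_ordinary p g d.
Proof.
have d1 : (1 < d)%N by case: hd => ->; lia.
have dp : (d < p)%N.
  apply: leq_trans hP; rewrite ltnS /Pplus -!mulnn.
  case: hd => ->; first by rewrite ifT; [nia|lia].
  by rewrite ifF; [rewrite leq_divRL //; nia|lia].
have podd : odd p.
  by case: (even_prime hp) => // p2; move: dp; rewrite p2; move: hg; case: hd => ->; lia.
have gp : (g < p)%N by apply: leq_trans dp; case: hd => ->; lia.
have dF (F : fieldType) : p \in [pchar F] -> d%:R != 0 :> F.
  move=> pF; rewrite -(dvdn_pcharf pF); apply/negP=> /(dvdn_leq (ltnW d1)).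
  by rewrite leqNgt dp.
pose hw := \det (hasse_witt g (trinomial d ('X : {poly {poly int}}) 'Y) p).
have ordinaryE (F : finFieldType) (s t : F) : p \in [pchar F] ->
    eval_st (disc_st d) s t != 0 ->
    ordinary p g (trinomial d s t) <-> eval_st hw s t != 0.
  move=> pF; rewrite eval_disc_st ?dF // => sep; rewrite eval_hasse_witt.
  by apply: ordinary_hasse_witt; rewrite ?monic_trinomial ?size_trinomial.
split; last first.
  exists (eq hw) => F s t pF D0; rewrite ordinaryE //.
  by split=> [hw0|[G [<- G0]]] //; exists hw.
(* The sizes over Z[t] bound those of [A] and [B] for every K, so K can be chosen large enough
   before reducing. *)
have [K pK cK] := pPrimePowerField hp (ltn0Sn (size hw + size (disc_st d))).
have [psi [psiX psiE]] := eval_st_poly (1 : K).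
pose A := map_poly psi hw; pose B := map_poly psi (disc_st d).
have A0 : A != 0.
  rewrite /A -det_map_mx map_hasse_witt map_trinomial /= map_polyX map_polyC /= psiX.
  exact: hasse_witt_trinomial_neq0.
(* The point s = 0 is a witness: x^d + 1 is separable as p does not divide d. *)
have B0 : B != 0.
  have : B.[0] != 0 by rewrite -psiE eval_disc_st ?dF // separable_XnD1 ?dF.
  by apply: contraNneq => ->; rewrite horner0.
have [s /andP[As Bs]|AB] := pickP (fun s => (A.[s] != 0) && (B.[s] != 0)).
  by exists K, s, 1; split; rewrite ?ordinaryE // psiE.
have AB0 : A * B != 0 by rewrite mulf_neq0.
have roots : all (root (A * B)) (enum K).
  apply/allP=> s _; rewrite rootM /root; have := AB s.
  by case: (A.[s] == 0) => //= /negbFE.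
have := max_poly_roots AB0 roots (enum_uniq K); rewrite -cardE cK ltnNge => /negP[].
rewrite (leq_trans (size_polyMleq _ _)) // (leq_trans (leq_pred _)) //.
have sA : (size A <= size hw)%N by apply: size_poly.
have sB : (size B <= size (disc_st d))%N by apply: size_poly.
rewrite (leq_trans (leq_add sA sB)) // (leq_trans (leqnSn _)) // ltnW //.
by rewrite ltn_expl // prime_gt1.
Qed.
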